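(* Suppose $\sum_{n}\frac{|a_n|}{\lambda_n}<\infty$ and fix a compact interval $I=[\alpha_0,\alpha_1]\subset(0,1)$. Suppose that for some $m\in\mathbb{N}$, $m\ge1$, one has $S_1=\cdots=S_{m-1}=0$ and $S_m\ne0$, and that $c_m(\alpha)=\frac{(-1)^{m+1}}{\Gamma(1-m\alpha)}\ne0$ for all $\alpha\in I$. Let $\rho>1$. There exist constants $C>0$ and $T>1$, depending only on the admissible interval $I$, on $\rho$, and on the known forward configuration (the eigenvalues $\lambda_n$ and coefficients $a_n$, hence also $m$), such that the following holds. Let $\alpha\in I$, $d_1=M_\alpha(t)$, $d_2=M_\alpha(\rho t)$, and let $\widetilde d_j=d_j(1+\varepsilon_j)$ with $\varepsilon_j\in\mathbb{R}$, $|\varepsilon_j|\le\eta<1$, $j=1,2$. For every $t\ge T$, the estimator formed from the noisy values, $$\widetilde\alpha_{\rm LR}=-\frac{1}{m\log\rho}\log\left|\frac{\widetilde d_2}{\widetilde d_1}\right|,$$ is defined and satisfies $$|\widetilde\alpha_{\rm LR}-\alpha|\le Ct^{-\alpha_0}+\frac{2[-\log(1-\eta)]}{m\log\rho}.$$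
   Context: Let $H$ be a real separable Hilbert space and $\mathcal{A}:\operatorname{Dom}(\mathcal{A})\subset H\to H$ a self-adjoint, strictly positive operator with compact resolvent, with eigenvalues counted with multiplicity $0<\lambda_1\le\lambda_2\le\cdots$ and an orthonormal eigenbasis $\{v_n\}$, $\mathcal{A}v_n=\lambda_nv_n$; in infinite dimensions $\lambda_n\to\infty$, and in finite dimensions the list of eigenvalues is finite and all spectral sums terminate accordingly. Let $\{a_n\}\subset\mathbb{R}$ be real coefficients. The resolvent moments are $S_k=\sum_{n}\frac{a_n}{\lambda_n^k}$, $k\ge1$. The scalar observation is $M_\alpha(t)=\sum_{n}a_nE_{\alpha,1}(-\lambda_nt^\alpha)$, $t>0$, $\alpha\in(0,1)$, where $E_{\alpha,1}(z)=\sum_{i\ge0}z^i/\Gamma(\alpha i+1)$ is the Mittag-Leffler function. The function $1/\Gamma$ is the entire reciprocal gamma function, vanishing at non-positive integers. *)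

(* Defs.v *)
From HB Require Import structures.
From mathcomp Require Import all_boot all_order all_algebra.
From mathcomp Require Import all_classical all_reals all_analysis.

Set Implicit Arguments.
Unset Strict Implicit.
Unset Printing Implicit Defensive.

Import Order.TTheory GRing.Theory Num.Theory.
Import numFieldNormedType.Exports.

Local Open Scope classical_set_scope.
Local Open Scope ring_scope.

Section HilbertSpace.
Context {R : realType}.

Definition separable_space (T : topologicalType) : Prop :=
  exists2 D : set T, countable D & dense D.

(* Completeness is part of the type of [H]. *)
Definition is_hilbert_inner_product (H : completeNormedModType R)
    (dot : {dot H for idfun}) : Prop :=
  forall x : H, `|x| ^+ 2 = dot x x.

Definition compact_operator (H : completeNormedModType R) (K : H -> H) : Prop :=
  forall B : set H, bounded_set B -> precompact (K @` B).

End HilbertSpace.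

(* A possibly unbounded operator is a domain [Dom] with a total function [A]
   whose values outside [Dom] are irrelevant. *)
Section UnboundedOperator.
Context {R : realType} {H : completeNormedModType R}.
Variables (dot : {dot H for idfun}) (Dom : set H) (A : H -> H).

Definition linear_operator : Prop :=
  Dom 0 /\ forall (c : R) (x y : H), Dom x -> Dom y ->
    Dom (c *: x + y) /\ A (c *: x + y) = c *: A x + A y.

(* [y] is in the domain of the adjoint, with image [z] (unique when [Dom] is
   dense). *)
Definition adjoint_graph (y z : H) : Prop :=
  forall x, Dom x -> dot (A x) y = dot x z.

Definition self_adjoint : Prop :=
  [/\ linear_operator, dense Dom &
      forall y z, adjoint_graph y z <-> Dom y /\ A y = z].

Definition strictly_positive : Prop :=
  forall x, Dom x -> x != 0 -> 0 < dot (A x) x.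

Definition is_resolvent (mu : R) (K : H -> H) : Prop :=
  (forall y, Dom (K y) /\ A (K y) - mu *: K y = y) /\
  (forall x, Dom x -> K (A x - mu *: x) = x).

(* One compact resolvent suffices: by the resolvent identity all the others
   are then compact. *)
Definition has_compact_resolvent : Prop :=
  exists mu : R, exists2 K : H -> H, is_resolvent mu K & compact_operator K.

End UnboundedOperator.

(* [None] stands for an infinite-dimensional space and [Some d] for a space of
   dimension [d]; eigenvalues are indexed from 0, and the terms of a sequence
   at the indices that are not [mode]s are irrelevant. *)
Definition mode (dim : option nat) (n : nat) : bool :=
  if dim is Some d then (n < d)%N else true.

Section SpectralConfiguration.
Context {R : realType} {H : completeNormedModType R}.
Variables (dot : {dot H for idfun}) (Dom : set H) (A : H -> H).
Variables (dim : option nat) (lambda : nat -> R) (v : nat -> H).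

Definition orthonormal_basis : Prop :=
  (forall i j, mode dim i -> mode dim j -> dot (v i) (v j) = (i == j)%:R) /\
  (forall x : H,
     (fun N => \sum_(0 <= n < N | mode dim n) dot x (v n) *: v n) @ \oo --> x).

(* As [v] is a basis, the list [lambda] automatically exhausts the spectrum,
   with multiplicities. *)
Record eigen_system : Prop := {
  eigenvalue_gt0 : forall n, mode dim n -> 0 < lambda n ;
  eigenvalue_nondecreasing : forall i j, (i <= j)%N -> mode dim j ->
    lambda i <= lambda j ;
  eigenvalue_cvg_pinfty : dim = None -> lambda @ \oo --> +oo ;
  eigenvector_basis : orthonormal_basis ;
  eigenvectorP : forall n, mode dim n ->
    Dom (v n) /\ A (v n) = lambda n *: v n }.

Record spectral_configuration : Prop := {
  configuration_inner_product : is_hilbert_inner_product dot ;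
  configuration_separable : separable_space H ;
  configuration_self_adjoint : self_adjoint dot Dom A ;
  configuration_strictly_positive : strictly_positive dot Dom A ;
  configuration_compact_resolvent : has_compact_resolvent Dom A ;
  configuration_eigen_system : eigen_system }.

End SpectralConfiguration.

Section SpecialFunctions.
Context {R : realType}.
Implicit Types x z alpha : R.

(* Euler's integral, meaningful for [0 < x]. *)
Definition Gamma x : R :=
  \int[@lebesgue_measure R]_(t in `]0, +oo[) (t `^ (x - 1) * expR (- t)).

(* The entire function 1 / Gamma on the real line: the recurrence
   1 / Gamma x = x (x + 1) ... (x + n - 1) / Gamma (x + n)
   for an [n] such that [0 < x + n]. *)
Definition rgamma x : R :=
  let n := (Num.truncn `|x|).+1 in
  (\prod_(0 <= k < n) (x + k%:R)) / Gamma (x + n%:R).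

(* E_{alpha,1} *)
Definition mittag_leffler1 alpha z : R :=
  limn (series (fun i => z ^+ i / Gamma (alpha * i%:R + 1))).

End SpecialFunctions.

Section Observation.
Context {R : realType}.
Variables (dim : option nat) (lambda a : nat -> R).

Definition spectral_sum (f : nat -> R) : R :=
  limn (fun N => \sum_(0 <= n < N | mode dim n) f n).

Definition resolvent_moment (k : nat) : R :=
  spectral_sum (fun n => a n / lambda n ^+ k).

Definition observation (alpha t : R) : R :=
  spectral_sum (fun n => a n * mittag_leffler1 alpha (- lambda n * t `^ alpha)).

End Observation.

Definition leading_coef {R : realType} (m : nat) (alpha : R) : R :=
  (-1) ^+ m.+1 * rgamma (1 - m%:R * alpha).

Definition log_ratio_estimator {R : realType} (m : nat) (rho d1 d2 : R) : R :=
  - (m%:R * ln rho)^-1 * ln `|d2 / d1|.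

(* Main.v *)
Require Import Defs.
From HB Require Import structures.
From mathcomp Require Import all_boot all_order all_algebra.
From mathcomp Require Import all_classical all_reals all_analysis.
From mathcomp Require Import measurable_realfun gauss_integral complex ring lra.

Set Implicit Arguments.
Unset Strict Implicit.
Unset Printing Implicit Defensive.

Import Order.TTheory GRing.Theory Num.Theory.
Import numFieldNormedType.Exports.

Local Open Scope classical_set_scope.
Local Open Scope ring_scope.

(** The estimator is the slope of log |M_alpha| between the times t and rho t on
    a logarithmic scale, so the bound follows from an expansion
      M_alpha(t) = c_m(alpha) S_m t^(- m alpha) (1 + O(t^(- alpha)))
    whose remainder is uniform in alpha. Applied to x = lambda_n t^alpha and
    summed over n, the expansion of E_alpha(- x) in powers of 1/x, with
    coefficients (-1)^(k+1) / Gamma(1 - k alpha), gives [observation_expansion]: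
    the first m - 1 terms carry the vanishing moments, and the remainders are
    summable because sum |a_n| / lambda_n is. By continuity of 1 / Gamma and
    compactness the leading coefficient is bounded away from 0
    ([leading_coef_lower]), and the noise enters the logarithm additively
    ([log_ratio_estimatorE]).

    The uniform expansion of the Mittag-Leffler function is
    [mittag_leffler_expansion]. Its source is Hankel's integral for 1 / Gamma,
    taken along the parabola w = z^2 with z = c + i y, on which the integrand
    has Gaussian decay:
      1 / Gamma(b) = 2 / pi int_0^oo Re (exp(z^2) z^(1 - 2 b)) dy.
    Summing the defining series of E_alpha under the integral sign gives
      E_alpha(- x) = 2 / pi int_0^oo Re (exp(z^2) z^(2 alpha - 1)
                                          / (z^(2 alpha) + x)) dy,
    at first for c large. The line can then be shifted to c = 2
    ([ml_shift]), because z^(2 alpha) + x does not vanish for Re z > 0 when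
    alpha < 1 ([ml_den_lower]). On that fixed line the geometric expansion of
    1 / (z^(2 alpha) + x) in powers of 1/x is legitimate for every x > 0, and its
    terms are again Hankel integrals. Both expansions iterate the single
    identity [ml_step].

    Hankel's formula is proved without residues. For b > 1, the power
    z^(1 - 2 b) is Euler's integral of tau^(2 b - 2) exp(- tau z) divided by
    Gamma(2 b - 1) ([complex_Gamma]); after an exchange of integrals the inner
    one is a Gaussian integral over a vertical line, which does not depend on
    the line ([int0y_gauss_line]), and there remains a Gaussian moment, which
    [Gamma_gauss_moment] evaluates; this last step is Legendre's duplication
    formula in disguise. Both sides satisfy the same recurrence in b
    ([hankel_rec], [GammaD1]), hence the formula for all real b
    ([hankel_rgamma]).

    All the functions involved are real on the real axis, so contour integrals
    are real parts of integrals over the half-line y > 0. Independence of the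
    contour is [int0y_param_const]: if d_s P = d_x T and T vanishes at both ends,
    then int P(s, x) dx does not depend on s. With the Cauchy-Riemann equations
    it is Cauchy's theorem for a strip ([contour_shift]). *)

(** * Complex exponentials and powers along curves *)

Section ComplexCalculus.
Local Open Scope complex_scope.
Local Open Scope ring_scope.
Context {R : realType}.
Implicit Types (f g : R -> R[i]) (x y p q : R) (z w : R[i]).
Import Normc.

(** Only curves are differentiated: a function of a real variable has a complex
    derivative when its two components have real ones. *)
Definition cderiv f x z : Prop :=
  is_derive x 1 (fun t => complex.Re (f t)) (complex.Re z) /\
  is_derive x 1 (fun t => complex.Im (f t)) (complex.Im z).

Definition cexp z : R[i] :=
  (expR (complex.Re z) * cos (complex.Im z))
    +i* (expR (complex.Re z) * sin (complex.Im z)).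

(** The principal logarithm on the right half-plane, the only place where its
    rules are stated; there [atan] gives the argument. *)
Definition clog z : R[i] :=
  (ln (complex.Re z ^+ 2 + complex.Im z ^+ 2) / 2)
    +i* atan (complex.Im z / complex.Re z).

Definition cpow z p : R[i] := cexp (p%:C * clog z)%C.

Lemma cderiv_eq f x z w : cderiv f x z -> z = w -> cderiv f x w.
Proof. by move=> + <-. Qed.

Lemma cderiv_cst z x : cderiv (fun=> z) x 0.
Proof. by split; apply: is_derive_cst. Qed.

Lemma cderivD f g x z w : cderiv f x z -> cderiv g x w ->
  cderiv (fun t => f t + g t) x (z + w).
Proof.
move=> [fr fi] [gr gi]; case: z w fr fi gr gi => [a b] [c d] /= fr fi gr gi.
split.
- rewrite [X in is_derive _ _ X _](_ : _ =
    (fun t => complex.Re (f t)) + (fun t => complex.Re (g t))); first exact: is_deriveD.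
  by apply/funext => t /=; rewrite fctE; case: (f t) (g t) => [? ?] [? ?].
- rewrite [X in is_derive _ _ X _](_ : _ =
    (fun t => complex.Im (f t)) + (fun t => complex.Im (g t))); first exact: is_deriveD.
  by apply/funext => t /=; rewrite fctE; case: (f t) (g t) => [? ?] [? ?].
Qed.

Lemma cderivM f g x z w : cderiv f x z -> cderiv g x w ->
  cderiv (fun t => f t * g t) x (z * g x + f x * w).
Proof.
move=> [fr fi] [gr gi].
split.
- rewrite [X in is_derive _ _ X _](_ : _ =
    (fun t => complex.Re (f t)) * (fun t => complex.Re (g t))
    - (fun t => complex.Im (f t)) * (fun t => complex.Im (g t))); last first.
    by apply/funext => t /=; rewrite !fctE; case: (f t) (g t) => [? ?] [? ?].
  apply: is_derive_eq.
  case: z w fr fi gr gi => [a b] [c d] /= _ _ _ _.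
  rewrite -![_ *: _]/(_ * _).
  by case: (f x) (g x) => [? ?] [? ?] /=; ring.
- rewrite [X in is_derive _ _ X _](_ : _ =
    (fun t => complex.Re (f t)) * (fun t => complex.Im (g t))
    + (fun t => complex.Im (f t)) * (fun t => complex.Re (g t))); last first.
    by apply/funext => t /=; rewrite !fctE; case: (f t) (g t) => [? ?] [? ?].
  apply: (is_derive_eq (is_deriveD (is_deriveM fr gi) (is_deriveM fi gr))).
  case: z w fr fi gr gi => [a b] [c d] /= _ _ _ _.
  rewrite -![_ *: _]/(_ * _).
  by case: (f x) (g x) => [? ?] [? ?] /=; ring.
Qed.

Lemma cderiv_real (h : R -> R) x d : is_derive x 1 h d ->
  cderiv (fun t => (h t)%:C) x d%:C.
Proof. by move=> hd; split => //=; exact: is_derive_cst. Qed.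

Lemma cderiv_line z w x : cderiv (fun t => z + t%:C * w) x w.
Proof.
have h : cderiv (fun t : R => t%:C) x 1%:C by apply: cderiv_real; exact: is_derive_id.
apply: cderiv_eq (cderivD (cderiv_cst z x) (cderivM h (cderiv_cst w x))) _.
by rewrite add0r mulr0 addr0 mul1r.
Qed.

Lemma cderiv_exp f x z : cderiv f x z ->
  cderiv (fun t => cexp (f t)) x (z * cexp (f x)).
Proof.
move=> [fr fi]; split.
- have -> : (fun t => complex.Re (cexp (f t))) =
    (expR \o (fun t => complex.Re (f t))) * (cos \o (fun t => complex.Im (f t))) by [].
  apply: is_derive_eq.
  case: z fr fi => [a b] /= _ _.
  rewrite -![_ *: _]/(_ * _).
  by case: (f x) => [? ?] /=; ring.
- have -> : (fun t => complex.Im (cexp (f t))) =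
    (expR \o (fun t => complex.Re (f t))) * (sin \o (fun t => complex.Im (f t))) by [].
  apply: is_derive_eq.
  case: z fr fi => [a b] /= _ _.
  rewrite -![_ *: _]/(_ * _).
  by case: (f x) => [? ?] /=; ring.
Qed.

Lemma cderivV f x z : f x != 0 -> cderiv f x z ->
  cderiv (fun t => (f t)^-1) x (- z / f x ^+ 2).
Proof.
move=> fx0 [fr fi].
have n0 : complex.Re (f x) ^+ 2 + complex.Im (f x) ^+ 2 != 0.
  move: fx0; apply: contra; case: (f x) => a b /=.
  by rewrite paddr_eq0 ?sqr_ge0// !sqrf_eq0 => /andP[/eqP-> /eqP->].
pose N : R -> R := (fun t => complex.Re (f t)) ^+ 2 + (fun t => complex.Im (f t)) ^+ 2.
have Nx : N x != 0 by [].
have dN : is_derive x 1 N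
    (2 * complex.Re (f x) * complex.Re z + 2 * complex.Im (f x) * complex.Im z).
  apply: (is_derive_eq (is_deriveD (is_deriveX 2 fr) (is_deriveX 2 fi))).
  rewrite /= !expr1 -![_ *: _]/(_ * _); ring.
have dV : is_derive x 1 (fun t => (N t)^-1) _ := @is_deriveV _ N x _ 1 Nx dN.
split.
- rewrite [X in is_derive _ _ X _](_ : _ =
    (fun t => complex.Re (f t)) * (fun t => (N t)^-1)); last first.
    by apply/funext => t /=; rewrite /N !fctE; case: (f t).
  apply: is_derive_eq.
  move: n0; rewrite /N !fctE.
  case: (f x) z {fr fi dN dV} => [a b] [c d] /= n0.
  rewrite -![_ *: _]/(_ * _).
  have e : (a * a - b * b) ^+ 2 + (a * b + b * a) ^+ 2 = (a ^+ 2 + b ^+ 2) ^+ 2 by ring.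
  by field; rewrite e expf_neq0.
- rewrite [X in is_derive _ _ X _](_ : _ =
    - (fun t => complex.Im (f t)) * (fun t => (N t)^-1)); last first.
    by apply/funext => t /=; rewrite /N !fctE; case: (f t) => ? ? /=; rewrite mulNr.
  apply: is_derive_eq.
  move: n0; rewrite /N !fctE.
  case: (f x) z {fr fi dN dV} => [a b] [c d] /= n0.
  rewrite -![_ *: _]/(_ * _).
  have e : (a * a - b * b) ^+ 2 + (a * b + b * a) ^+ 2 = (a ^+ 2 + b ^+ 2) ^+ 2 by ring.
  by field; rewrite e expf_neq0.
Qed.

Lemma cderiv_log f x z : 0 < complex.Re (f x) -> cderiv f x z ->
  cderiv (fun t => clog (f t)) x (z / f x).
Proof.
move=> fx0 [fr fi].
have n0 : 0 < complex.Re (f x) ^+ 2 + complex.Im (f x) ^+ 2.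
  by rewrite ltr_wpDr ?sqr_ge0// exprn_gt0.
pose N : R -> R := (fun t => complex.Re (f t)) ^+ 2 + (fun t => complex.Im (f t)) ^+ 2.
have dN : is_derive x 1 N
    (2 * complex.Re (f x) * complex.Re z + 2 * complex.Im (f x) * complex.Im z).
  apply: (is_derive_eq (is_deriveD (is_deriveX 2 fr) (is_deriveX 2 fi))).
  rewrite /= !expr1 -![_ *: _]/(_ * _); ring.
pose V : R -> R := (fun t => complex.Im (f t)) * (fun t => (complex.Re (f t))^-1).
have rx0 : (fun t => complex.Re (f t)) x != 0 by rewrite gt_eqF.
have dV := @is_deriveV _ _ x _ 1 rx0 fr.
have dQ : is_derive x 1 V _ := @is_deriveM _ _ _ _ _ _ _ _ fi dV.
split.
- rewrite [X in is_derive _ _ X _](_ : _ = 2^-1 *: ((@ln R) \o N : R -> R)); last first.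
    by apply/funext => t /=; rewrite /N !fctE mulrC.
  have dl : is_derive (N x) 1 (@ln R) (N x)^-1 := is_derive1_ln n0.
  have dL := @is_deriveZ _ _ _ ((@ln R) \o N : R -> R) 2^-1 x 1 _ (is_derive1_comp dl dN).
  apply: (is_derive_eq dL).
  move: n0 fx0 {dL dQ dV dN}; rewrite /N !fctE.
  case: (f x) z {fr fi rx0} => [a b] [c d] /= n0 fx0.
  have n1 := lt0r_neq0 n0.
  by rewrite -![_ *: _]/(_ * _); field.
- rewrite [X in is_derive _ _ X _](_ : _ = (atan \o V)); last first.
    by apply/funext => t /=.
  have dL := is_derive1_comp (is_derive1_atan (V x)) dQ.
  apply: (is_derive_eq dL).
  move: n0 fx0 {dL dQ dV dN}; rewrite /V !fctE.
  case: (f x) z {fr fi rx0} => [a b] [c d] /= n0 fx0.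
  rewrite -![_ *: _]/(_ * _).
  have n1 := lt0r_neq0 n0. have n2 := lt0r_neq0 fx0.
  by field; rewrite n2 andbC n1.
Qed.

Lemma cexpD z w : cexp (z + w) = cexp z * cexp w.
Proof.
case: z w => [a b] [c d]; rewrite /cexp /= expRD cosD sinD.
by apply/eqP; rewrite eq_complex /=; apply/andP; split; apply/eqP; ring.
Qed.

Lemma cexp0 : cexp 0 = 1.
Proof. by rewrite /cexp /= expR0 cos0 sin0 mul1r mulr0. Qed.

Lemma cexp_neq0 z : cexp z != 0.
Proof.
apply/negP => /eqP z0.
have := cexpD z (- z); rewrite subrr cexp0 z0 mul0r => /eqP.
by rewrite oner_eq0.
Qed.

Lemma normc_exp z : normc (cexp z) = expR (complex.Re z).
Proof.
case: z => a b; rewrite /cexp /=.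
by rewrite !exprMn -mulrDr cos2Dsin2 mulr1 sqrtr_sqr ger0_norm//.
Qed.

Lemma cexpK z : 0 < complex.Re z -> cexp (clog z) = z.
Proof.
case: z => a b /= a0; rewrite /cexp /clog /=.
have h0 : 0 < a ^+ 2 + b ^+ 2 by rewrite ltr_wpDr ?sqr_ge0// exprn_gt0.
have c0 : 0 < 1 + (b / a) ^+ 2 by rewrite ltr_wpDr ?sqr_ge0.
have -> : expR (ln (a ^+ 2 + b ^+ 2) / 2) = a * Num.sqrt (1 + (b / a) ^+ 2).
  rewrite expRM lnK ?posrE// powR12_sqrt ?ltW//.
  rewrite -{2}(ger0_norm (ltW a0)) -sqrtr_sqr -sqrtrM ?sqr_ge0//.
  by congr Num.sqrt; field; rewrite gt_eqF.
have ce := cos_atan (b / a).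
have s0 : Num.sqrt (1 + (b / a) ^+ 2) != 0 by rewrite gt_eqF// sqrtr_gt0.
have cn0 : cos (atan (b / a)) != 0 by rewrite ce invr_eq0.
have -> : sin (atan (b / a)) = b / a / Num.sqrt (1 + (b / a) ^+ 2).
  by rewrite -{2}(atanK (b / a)) /tan ce invrK -mulrA divff// mulr1.
rewrite ce; apply/eqP; rewrite eq_complex /=.
apply/andP; split; apply/eqP; first by rewrite -mulrA divff// mulr1.
by field; rewrite s0 gt_eqF.
Qed.

Lemma ler_normc_Re z : `|complex.Re z| <= normc z.
Proof. by case: z => a b /=; rewrite -sqrtr_sqr ler_wsqrtr// lerDl sqr_ge0. Qed.

Lemma ler_normc_Im z : `|complex.Im z| <= normc z.
Proof. by case: z => a b /=; rewrite -sqrtr_sqr ler_wsqrtr// lerDr sqr_ge0. Qed.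

Lemma normc_ge0 z : 0 <= normc z.
Proof. by case: z => a b /=; exact: sqrtr_ge0. Qed.

Lemma normc_real x : normc x%:C = `|x|.
Proof. by rewrite /= expr0n addr0 sqrtr_sqr. Qed.

Lemma normc_sqr z : normc z ^+ 2 = complex.Re z ^+ 2 + complex.Im z ^+ 2.
Proof. by case: z => a b /=; rewrite sqr_sqrtr// addr_ge0 ?sqr_ge0. Qed.

Lemma normc_gt0 z : 0 < complex.Re z -> 0 < normc z.
Proof.
move=> z0; apply: lt_le_trans (ler_normc_Re z).
by rewrite normr_gt0 gt_eqF.
Qed.

Lemma normc_pow z p : 0 < complex.Re z -> normc (cpow z p) = normc z `^ p.
Proof.
move=> z0; rewrite /cpow normc_exp /clog.
rewrite -normc_sqr lnXn ?normc_gt0//= !mul0r subr0.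
by rewrite [in RHS]/powR gt_eqF ?normc_gt0//; congr expR; field.
Qed.

Lemma cpowD z p q : cpow z (p + q) = cpow z p * cpow z q.
Proof. by rewrite /cpow -cexpD -mulrDl rmorphD. Qed.

Lemma cpow0 z : cpow z 0 = 1.
Proof. by rewrite /cpow mul0r cexp0. Qed.

Lemma cpow1 z : 0 < complex.Re z -> cpow z 1 = z.
Proof. by move=> z0; rewrite /cpow mul1r cexpK. Qed.

Lemma cpow_neq0 z p : cpow z p != 0.
Proof. exact: cexp_neq0. Qed.

Lemma cpowN z p : cpow z (- p) = (cpow z p)^-1.
Proof.
by apply: (mulfI (cpow_neq0 z p)); rewrite -cpowD subrr cpow0 divff// cpow_neq0.
Qed.

Lemma cpow_real x p : 0 < x -> cpow x%:C p = (x `^ p)%:C.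
Proof.
move=> x0; rewrite /cpow /clog /cexp /= !mul0r atan0 expr0n /= mulr0 !addr0 cos0 sin0.
rewrite mulr0 mulr1 subr0 lnXn// [in RHS]/powR gt_eqF//.
by apply/eqP; rewrite eq_complex /= eqxx andbT; apply/eqP; congr expR; field.
Qed.

Lemma cderiv_pow f x z p : 0 < complex.Re (f x) -> cderiv f x z ->
  cderiv (fun t => cpow (f t) p) x (p%:C * cpow (f x) (p - 1) * z).
Proof.
move=> fx0 df.
have dL := cderivM (cderiv_cst p%:C x) (cderiv_log fx0 df).
apply: (cderiv_eq (cderiv_exp dL)).
rewrite mul0r add0r cpowD cpowN cpow1// /cpow; ring.
Qed.

(** Used to get continuity of derivatives, for which the value of the second
    derivative is irrelevant. *)
Definition cdiff f x := exists z, cderiv f x z.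

Lemma cdiffD f g x : cdiff f x -> cdiff g x -> cdiff (fun t => f t + g t) x.
Proof. by move=> [z fz] [w gw]; eexists; exact: (cderivD fz gw). Qed.

Lemma cdiffM f g x : cdiff f x -> cdiff g x -> cdiff (fun t => f t * g t) x.
Proof. by move=> [z fz] [w gw]; eexists; exact: (cderivM fz gw). Qed.

Lemma cdiffV f x : f x != 0 -> cdiff f x -> cdiff (fun t => (f t)^-1) x.
Proof. by move=> f0 [z fz]; eexists; exact: (cderivV f0 fz). Qed.

Lemma cdiff_cst z x : cdiff (fun=> z) x.
Proof. by exists 0; exact: cderiv_cst. Qed.

Lemma cdiff_exp f x : cdiff f x -> cdiff (fun t => cexp (f t)) x.
Proof. by move=> [z fz]; eexists; exact: (cderiv_exp fz). Qed.

Lemma cdiff_pow f x p : 0 < complex.Re (f x) -> cdiff f x ->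
  cdiff (fun t => cpow (f t) p) x.
Proof. by move=> f0 [z fz]; eexists; exact: (cderiv_pow p f0 fz). Qed.

Lemma cdiff_line z w x : cdiff (fun t => z + t%:C * w) x.
Proof. by exists w; exact: cderiv_line. Qed.

Lemma cdiffX f x n : cdiff f x -> cdiff (fun t => f t ^+ n) x.
Proof.
move=> df; elim: n => [|n ih]; first exact: cdiff_cst.
rewrite (_ : (fun _ => _) = fun t => f t * f t ^+ n); first exact: cdiffM.
by apply/funext => t; rewrite exprS.
Qed.

Lemma cdiff_continuous_Re f x : cdiff f x ->
  {for x, continuous (fun t => complex.Re (f t))}.
Proof.
move=> [z [[h _] _]]; apply/differentiable_continuous.
exact/derivable1_diffP.
Qed.

End ComplexCalculus.

(** * Integrals over the half-line *)

Section HalfLine.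
Context {R : realType}.
Implicit Types (f g F G : R -> R) (a b x y l : R).
Local Notation mu := (@lebesgue_measure R).
Local Notation D0y := (`]0, +oo[%classic : set R).

Definition integrable0y f := mu.-integrable D0y (EFin \o f).
Definition int0y f : R := \int[mu]_(x in D0y) f x.

Lemma itv0y_gt0 x : D0y x -> 0 < x.
Proof. by rewrite /= in_itv/= andbT. Qed.

Lemma integrable0y_le f g : (forall x, 0 < x -> {for x, continuous f}) ->
  integrable0y g -> (forall x, 0 < x -> `|f x| <= g x) -> integrable0y f.
Proof.
move=> cf ig fg.
have mf : measurable_fun D0y f.
  apply: open_continuous_measurable_fun => //.
  by move=> x /[!inE] /itv0y_gt0; exact: cf.
apply: (le_integrable _ _ _ ig) => //=; first exact/measurable_EFinP.
move=> x /itv0y_gt0 x0.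
by rewrite lee_fin (le_trans (fg _ x0))// ler_norm.
Qed.

Lemma int0yE f : integrable0y f ->
  (\int[mu]_(x in D0y) (f x)%:E)%E = (int0y f)%:E.
Proof. by move=> fi; rewrite /int0y /Rintegral fineK//; exact: integrable_fin_num. Qed.

Lemma eq_int0y f g : (forall x, 0 < x -> f x = g x) -> int0y f = int0y g.
Proof. by move=> fg; apply: eq_Rintegral => x /[!inE] /itv0y_gt0; exact: fg. Qed.

Lemma eq_integrable0y f g : (forall x, 0 < x -> f x = g x) ->
  integrable0y f -> integrable0y g.
Proof.
move=> fg; apply: eq_integrable => // x /[!inE] /itv0y_gt0 x0.
by rewrite /= fg.
Qed.

Lemma integrable0yD f g : integrable0y f -> integrable0y g ->
  integrable0y (fun x => f x + g x).
Proof.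
move=> fi gi; rewrite /integrable0y.
rewrite (_ : EFin \o _ = (EFin \o f) \+ (EFin \o g))%E//.
exact: integrableD.
Qed.

Lemma integrable0yZ a f : integrable0y f -> integrable0y (fun x => a * f x).
Proof.
move=> fi; rewrite /integrable0y.
rewrite (_ : EFin \o _ = (fun x => a%:E * (EFin \o f) x))%E//.
exact: integrableZl.
Qed.

Lemma int0yD f g : integrable0y f -> integrable0y g ->
  int0y (fun x => f x + g x) = int0y f + int0y g.
Proof. by move=> fi gi; rewrite /int0y RintegralD. Qed.

Lemma int0yZ a f : integrable0y f -> int0y (fun x => a * f x) = a * int0y f.
Proof. by move=> fi; rewrite /int0y RintegralZl. Qed.

Lemma ler_int0y f g : integrable0y f -> integrable0y g ->
  (forall x, 0 < x -> f x <= g x) -> int0y f <= int0y g.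
Proof.
move=> fi gi fg; apply: le_Rintegral => // x /itv0y_gt0; exact: fg.
Qed.

Lemma ler_norm_int0y f g : (forall x, 0 < x -> {for x, continuous f}) ->
  integrable0y g -> (forall x, 0 < x -> `|f x| <= g x) -> `|int0y f| <= int0y g.
Proof.
move=> cf gi fg; have fi := integrable0y_le cf gi fg.
apply: le_trans (le_normr_Rintegral _ fi) _ => //.
by apply: ler_int0y => //; rewrite /integrable0y; exact: (integrable_norm fi).
Qed.

(** A compact exhaustion of the half-line: the indices are shifted so that the
    intervals are never degenerate. *)
Definition trunc0y f n : R -> \bar R :=
  (EFin \o f) \_ (`[n.+1%:R^-1, n.+2%:R]%classic : set R).

Lemma trunc0y_itv n x : x \in `[n.+1%:R^-1, n.+2%:R] -> 0 < x.
Proof. by rewrite in_itv/= => /andP[+ _]; apply: lt_le_trans; rewrite invr_gt0. Qed.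

Lemma trunc0y_near f x : 0 < x -> \forall n \near \oo, trunc0y f n x = (f x)%:E.
Proof.
move=> x0.
have bcv : n.+2%:R @[n --> \oo] --> (+oo : set_system R).
  by have := @cvgr_idn R; rewrite -cvg_shiftS -cvg_shiftS.
have acv : n.+1%:R^-1 @[n --> \oo] --> (0 : R) by exact: cvg_harmonic.
near=> n.
rewrite /trunc0y patchE ifT// inE/= in_itv/=; apply/andP; split; near: n.
- move/cvgrPdist_le : acv => /(_ _ x0); apply: filterS => n /=.
  by rewrite sub0r normrN gtr0_norm.
- by move/cvgryPge : bcv; exact.
Unshelve. all: by end_near. Qed.

Lemma measurable_trunc0y f n : (forall x, 0 < x -> {for x, continuous f}) ->
  measurable_fun D0y (trunc0y f n).
Proof.
move=> cf; have mf : measurable_fun D0y (EFin \o f).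
  apply/measurable_EFinP; apply: open_continuous_measurable_fun => //.
  by move=> x /[!inE] /itv0y_gt0; exact: cf.
apply/measurable_restrict => //.
by apply: measurable_funS mf => // x [].
Qed.

Lemma cvg_int_trunc0y F f l0 (ly : R) :
  (forall x, 0 < x -> is_derive x 1 F (f x)) ->
  (forall x, 0 < x -> {for x, continuous f}) ->
  F x @[x --> 0^'+] --> l0 -> F x @[x --> +oo] --> ly ->
  (\int[mu]_(x in D0y) trunc0y f n x)%E @[n --> \oo] --> (ly - l0)%:E.
Proof.
move=> dF cf F0 Fy.
pose a n : R := n.+1%:R^-1; pose b n : R := n.+2%:R.
have a0 n : 0 < a n by rewrite invr_gt0.
have ab n : a n < b n.
  by rewrite (@le_lt_trans _ _ 1)// ?invf_le1 ?ler1n ?ltr1n.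
have abS n x : x \in `[a n, b n] -> 0 < x by exact: trunc0y_itv.
have key n : (\int[mu]_(x in `[a n, b n]) (f x)%:E = (F (b n) - F (a n))%:E)%E.
  rewrite EFinB; apply: continuous_FTC2 => //.
  - apply: continuous_in_subspaceT => x /[!inE]/= /abS x0; exact: cf.
  - split.
    + move=> x /subset_itv_oo_cc/= /abS x0.
      by have [] := dF _ x0.
    + apply: cvg_at_right_filter.
      have [/derivable1_diffP/differentiable_continuous h _] := dF _ (a0 n).
      exact: h.
    + apply: cvg_at_left_filter.
      have [/derivable1_diffP/differentiable_continuous h _] := dF _ (lt_trans (a0 n) (ab n)).
      exact: h.
  - move=> x /subset_itv_oo_cc/= /abS x0.
    by rewrite derive1E; have [_] := dF _ x0.
have keyD n : (\int[mu]_(x in D0y) trunc0y f n x = (F (b n) - F (a n))%:E)%E.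
  rewrite /trunc0y -integral_mkcondr setIidr; first exact: key.
  by move=> x /= /abS x0; rewrite in_itv/= andbT.
under eq_fun do rewrite keyD.
have bcv : b n @[n --> \oo] --> +oo.
  by have := @cvgr_idn R; rewrite -cvg_shiftS -cvg_shiftS.
have acv : a n @[n --> \oo] --> 0 by exact: cvg_harmonic.
apply: cvg_EFin; first exact: nearW.
apply: cvgB; first by move/cvg_pinftyP : Fy; exact.
by move/cvg_at_rightP : F0; apply.
Qed.

(** The fundamental theorem of calculus on the compact exhaustion, and dominated
    convergence by the integrable derivative itself. *)
Lemma int0y_deriv F f l0 (ly : R) :
  (forall x, 0 < x -> is_derive x 1 F (f x)) ->
  (forall x, 0 < x -> {for x, continuous f}) ->
  integrable0y f -> F x @[x --> 0^'+] --> l0 -> F x @[x --> +oo] --> ly ->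
  int0y f = ly - l0.
Proof.
move=> dF cf fi F0 Fy.
have limD := cvg_int_trunc0y dF cf F0 Fy.
have mD : measurable D0y by [].
have [|||||_ _] := @dominated_convergence _ _ _ mu D0y mD (trunc0y f)
    (EFin \o f) (EFin \o (Num.norm \o f)).
- by move=> n; exact: measurable_trunc0y.
- exact: (measurable_int mu fi).
- apply/aeW => x /itv0y_gt0 x0.
  by apply: cvg_near_cst; exact: trunc0y_near.
- exact: (integrable_norm fi).
- apply/aeW => x n _; rewrite /trunc0y patchE; case: ifPn => _ //=.
  by rewrite normr0 lee_fin.
move=> lim.
have : (\int[mu]_(x in D0y) (f x)%:E)%E = (ly - l0)%:E.
  by apply: (cvg_unique _ lim limD); exact: ereal_hausdorff.
by rewrite int0yE// => -[].
Qed.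

(** For a nonnegative derivative, monotone convergence replaces the domination
    assumed in [int0y_deriv], and integrability becomes a conclusion. *)
Lemma integrable0y_deriv F f l0 (ly : R) :
  (forall x, 0 < x -> is_derive x 1 F (f x)) ->
  (forall x, 0 < x -> {for x, continuous f}) ->
  (forall x, 0 < x -> 0 <= f x) ->
  F x @[x --> 0^'+] --> l0 -> F x @[x --> +oo] --> ly ->
  integrable0y f.
Proof.
move=> dF cf f0 F0 Fy.
have limD := cvg_int_trunc0y dF cf F0 Fy.
have mD : measurable D0y by [].
have mf : measurable_fun D0y (EFin \o f).
  apply/measurable_EFinP; apply: open_continuous_measurable_fun => //.
  by move=> x /[!inE] /itv0y_gt0; exact: cf.
have t0 n x : D0y x -> (0 <= trunc0y f n x)%E.
  move=> /itv0y_gt0 x0; rewrite /trunc0y patchE; case: ifPn => //= _.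
  by rewrite lee_fin f0.
have nd x : D0y x -> {homo (trunc0y f) ^~ x : n m / (n <= m)%N >-> (n <= m)%E}.
  move=> /itv0y_gt0 x0 m n mn; rewrite /trunc0y !patchE.
  case: ifPn => [|_]; last by case: ifPn => //= _; rewrite lee_fin f0.
  rewrite inE/= in_itv/= => /andP[mx xm]; rewrite ifT// inE/= in_itv/=.
  rewrite (le_trans _ mx)/= ?(le_trans xm) ?ler_nat ?ltnS//.
  by rewrite lef_pV2 ?posrE// ler_nat ltnS.
have lim : (\int[mu]_(x in D0y) trunc0y f n x)%E @[n --> \oo] -->
    (\int[mu]_(x in D0y) (f x)%:E)%E.
  rewrite (_ : (\int[mu]_(x in D0y) (f x)%:E)%E =
      (\int[mu]_(x in D0y) (limn (trunc0y f ^~ x)))%E).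
    by apply: cvg_monotone_convergence => // n; exact: measurable_trunc0y.
  apply: eq_integral => x /[!inE] /itv0y_gt0 x0.
  apply/esym/cvg_lim; first exact: ereal_hausdorff.
  by apply: cvg_near_cst; exact: trunc0y_near.
have e : (\int[mu]_(x in D0y) (f x)%:E)%E = (ly - l0)%:E.
  by apply: (cvg_unique _ lim limD); exact: ereal_hausdorff.
apply/integrableP; split => //.
rewrite (_ : integral _ _ _ = (ly - l0)%:E) ?ltry// -e.
apply: eq_integral => x /[!inE] /itv0y_gt0 x0.
by rewrite /= ger0_norm ?f0.
Qed.

Lemma derive0_const f u v a b : u < a < v -> u < b < v ->
  (forall x, u < x < v -> is_derive x 1 f 0) -> f a = f b.
Proof.
wlog ab : a b / a <= b.
  by move=> H ha hb df; have [ab|/ltW ba] := leP a b; [exact: H|symmetry; exact: H].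
move=> /andP[ua av] /andP[ub bv] df.
have sub x : a <= x <= b -> u < x < v.
  by move=> /andP[ax xb]; rewrite (lt_le_trans ua)//= (le_lt_trans xb).
have [||c _] := @MVT_segment _ f (fun=> 0) a b ab.
- by move=> x /subset_itv_oo_cc/=; rewrite in_itv => /sub; exact: df.
- apply: continuous_in_subspaceT => x /[!inE]/=; rewrite in_itv => /sub /df [h _].
  by apply: differentiable_continuous; exact/derivable1_diffP.
- by rewrite mul0r => /eqP; rewrite subr_eq0 => /eqP.
Qed.

(** Differentiating under the integral sign, the derivative in s of the integral
    of P is the integral of d_x T, that is, the difference of the limits of T at
    the two ends. This one principle is the source of every contour deformation
    below. *)
Lemma int0y_param_const (P T g : R -> R -> R) (G : R -> R) u v a b :
  u < a < v -> u < b < v ->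
  (forall s, u < s < v -> integrable0y (P s)) ->
  (forall s x, u < s < v -> 0 < x -> is_derive s 1 (P ^~ x) (g s x)) ->
  (forall s x, u < s < v -> 0 < x -> is_derive x 1 (T s) (g s x)) ->
  (forall s x, u < s < v -> 0 < x -> {for x, continuous (g s)}) ->
  (forall x, 0 <= G x) -> integrable0y G ->
  (forall s x, u < s < v -> 0 < x -> `|g s x| <= G x) ->
  (forall s, u < s < v -> T s x @[x --> 0^'+] --> (0 : R)) ->
  (forall s, u < s < v -> T s x @[x --> +oo] --> (0 : R)) ->
  int0y (P a) = int0y (P b).
Proof.
move=> ha hb iP dP dT cg G0 iG gG T0 Ty.
apply: (@derive0_const (fun s => int0y (P s)) u v a b ha hb) => s hs.
have Is : (`]u, v[%classic : set R) s by rewrite /= in_itv.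
have hI t : (`]u, v[%classic : set R) t -> u < t < v by rewrite /= in_itv.
have dP1 t x : u < t < v -> 0 < x -> partial1of2 P t x = g t x.
  by move=> ht x0; rewrite partial1of2E; have [_] := dP _ _ ht x0.
have ifg t : (`]u, v[%classic : set R) t -> mu.-integrable D0y (EFin \o P t).
  by move=> /hI; exact: iP.
have der t x : (`]u, v[%classic : set R) t -> D0y x ->
    derivable (P ^~ x) t 1.
  by move=> /hI ht /itv0y_gt0 x0; have [] := dP _ _ ht x0.
have ub t x : (`]u, v[%classic : set R) t -> D0y x ->
    `|partial1of2 P t x| <= G x.
  by move=> /hI ht /itv0y_gt0 x0; rewrite dP1//; exact: gG.
have D1 := @differentiation_under_integral R _ _ mu P D0y (measurable_itv _)
  s u v Is ifg der G G0 iG ub.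
have D2 := @derivable_under_integral R _ _ mu P D0y (measurable_itv _)
  s u v Is ifg der G G0 iG ub.
apply: DeriveDef => //.
rewrite -derive1E D1.
transitivity (int0y (g s)).
  by apply: eq_int0y => x x0; rewrite dP1.
rewrite -[RHS](subrr 0).
apply: (@int0y_deriv (T s)).
- by move=> x x0; exact: dT.
- by move=> x x0; exact: cg.
- by apply: (@integrable0y_le (g s) G) => // x x0; [exact: cg|exact: gG].
- exact: T0.
- exact: Ty.
Qed.

End HalfLine.

(** * Euler's Gamma function *)

Section EulerGamma.
Context {R : realType}.
Implicit Types (f g F G : R -> R) (a b c x y l s t w : R).
Local Notation mu := (@lebesgue_measure R).
Local Notation D0y := (`]0, +oo[%classic : set R).

Lemma is_derive_powR p x : 0 < x ->
  is_derive x 1 (fun t : R => t `^ p) (p * x `^ (p - 1)).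
Proof.
move=> x0; have xD : x \in `]0, +oo[ by rewrite in_itv/= x0.
apply: DeriveDef; first exact: derivable_powR.
by rewrite -derive1E powR_derive1.
Qed.

Lemma is_derive_expRM c x :
  is_derive x 1 (fun t : R => expR (c * t)) (c * expR (c * x)).
Proof.
have h : is_derive x 1 (fun t : R => c * t) c.
  by apply: is_derive_eq; rewrite -![_ *: _]/(_ * _) mulr1.
have -> : (fun t : R => expR (c * t)) = expR \o (fun t => c * t) by [].
by apply: is_derive_eq; rewrite mulrC.
Qed.

Lemma is_derive_continuous f x l : is_derive x 1 f l -> {for x, continuous f}.
Proof.
by move=> [h _]; apply: differentiable_continuous; exact/derivable1_diffP.
Qed.

(** A power is bounded by a monomial, which is a single term of the exponential
    series up to a constant. *)
Lemma powR_le_expR (q c : R) : 0 < c ->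
  exists2 K, 0 < K & forall u, 1 <= u -> u `^ q <= K * expR (c * u).
Proof.
move=> c0; pose n := (Num.truncn `|q|).+1.
have qn : q <= n%:R.
  by rewrite (le_trans (ler_norm _))// ltW// truncnS_gt.
have cn0 : 0 < c ^+ n by rewrite exprn_gt0.
have fn0 : (0 : R) < n`!%:R by rewrite ltr0n fact_gt0.
exists (n`!%:R / c ^+ n); first by rewrite divr_gt0.
move=> u u1; have u0 : 0 <= u by rewrite (le_trans _ u1).
apply: (le_trans (ler_powR u1 qn)); rewrite powR_mulrn//.
have := expR_ge1Dxn n.-1 (mulr_ge0 (ltW c0) u0).
rewrite prednK// exprMn => h.
rewrite mulrAC ler_pdivlMr// mulrC -ler_pdivrMl// mulrC.
apply: le_trans h.
rewrite [leLHS](_ : _ = c ^+ n * u ^+ n / n`!%:R); last by ring.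
by rewrite lerDr.
Qed.

Lemma cvg0_expR_bound f K c : 0 < c ->
  (forall t, 1 <= t -> `|f t| <= K * expR (- c * t)) -> f @ +oo --> (0 : R).
Proof.
move=> c0 hf.
apply: norm_cvg0.
apply: (@squeeze_cvgr _ _ _ _ (fun=> 0) (fun t => K * expR (- (c * t)))).
- near=> t; rewrite normr_ge0/= -mulNr; apply: hf.
  by near: t; apply: nbhs_pinfty_ge; rewrite num_real.
- exact: cvg_cst.
- rewrite -[X in _ --> X](mulr0 K); apply: cvgM; first exact: cvg_cst.
  apply: (@cvg_comp _ _ _ (fun t => c * t) (fun t => expR (- t)) _ +oo).
    apply: gt0_cvgMry => //; exact: cvg_id.
  exact: cvgr_expR.
Unshelve. all: by end_near. Qed.

(** Up to a constant the integrand is dominated by the derivative of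
    (t / (1 + t)) ^ x, a bounded monotone function: this treats the singularity
    at 0 and the tail at the same time. *)
Lemma integrable0y_Gamma x c : 0 < x -> 0 < c ->
  integrable0y (fun t : R => t `^ (x - 1) * expR (- c * t)).
Proof.
move=> x0 c0.
(* the dominating function is the derivative of V ^ x *)
pose V t : R := t * (1 + t)^-1.
have dV t : 0 < t -> is_derive t 1 V ((1 + t) * (1 + t))^-1.
  move=> t0; have t1 : (fun s : R => 1 + s) t != 0.
    by rewrite /= gt_eqF// addr_gt0.
  have d1 : is_derive t 1 (fun s : R => 1 + s) 1.
    have d := is_deriveD (is_derive_cst (1 : R) t 1) (is_derive_id t (1 : R)).
    by apply: (is_derive_eq d); rewrite add0r.
  have d2 := is_deriveV t1 d1.
  have d3 : is_derive t 1 V _ := is_deriveM (is_derive_id t 1) d2.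
  apply: (is_derive_eq d3).
  rewrite -![_ *: _]/(_ * _) /=; field; exact: t1.
have V0 t : 0 < t -> 0 < V t by move=> t0; rewrite divr_gt0// addr_gt0.
pose F t : R := (V t) `^ x.
pose f t : R := x * V t `^ (x - 1) * ((1 + t) * (1 + t))^-1.
have dF t : 0 < t -> is_derive t 1 F (f t).
  by move=> t0; exact: (is_derive1_comp (is_derive_powR x (V0 _ t0)) (dV _ t0)).
have cf t : 0 < t -> {for t, continuous f}.
  move=> t0; have t1 : 1 + t != 0 by rewrite gt_eqF// addr_gt0.
  apply: cvgM; first apply: cvgM; first exact: cvg_cst.
  - by have /is_derive_continuous := is_derive1_comp (is_derive_powR (x - 1) (V0 _ t0)) (dV _ t0).
  - apply: cvgV; first by rewrite mulf_neq0.
    by apply: cvgM; (apply: cvgD; [exact: cvg_cst|exact: cvg_id]).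
have f0 t : 0 < t -> 0 <= f t.
  move=> t0; rewrite mulr_ge0 ?invr_ge0 -?expr2 ?sqr_ge0// mulr_ge0 ?powR_ge0//.
  exact: ltW.
have F0 : F t @[t --> 0^'+] --> (0 : R).
  apply: (@squeeze_cvgr _ _ _ _ (fun=> 0) (fun t => t `^ x)).
  - near=> t; have t0 : 0 < t by near: t; exact: nbhs_right_gt.
    rewrite powR_ge0/=; apply: ge0_ler_powR; rewrite ?nnegrE ?ltW ?V0//.
    by rewrite ltr_pdivrMr ?addr_gt0// ltr_pMr// ltrDl.
  - exact: cvg_cst.
  - exact: powR_cvg0.
have Fy : F t @[t --> +oo] --> (1 : R).
  have <- : 1 `^ x = 1 :> R by rewrite powR1.
  apply: (@cvg_comp _ _ _ V (fun t => t `^ x) _ (nbhs (1 : R))).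
    apply: (@cvg_trans _ ((fun t : R => 1 - (1 + t)^-1) @ +oo)).
      apply: near_eq_cvg; near=> t.
      have t0 : 0 < t by near: t; apply: nbhs_pinfty_gt; rewrite num_real.
      by rewrite /V; field; rewrite gt_eqF// addr_gt0.
    suff : (fun t : R => 1 - (1 + t)^-1) @ +oo --> (1 - 0 : R) by rewrite subr0.
    apply: cvgB; first exact: cvg_cst.
    apply/cvgrPdist_lt => e e0; near=> t.
    have t0 : 0 < t by near: t; apply: nbhs_pinfty_gt; rewrite num_real.
    rewrite sub0r normrN gtr0_norm ?invr_gt0 ?addr_gt0//.
    rewrite invf_plt ?posrE ?addr_gt0//.
    rewrite (@lt_trans _ _ t)// ?ltrDr//.
    by near: t; apply: nbhs_pinfty_gt; rewrite num_real.
  by have /is_derive_continuous := is_derive_powR x (@ltr01 R).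
have fi := integrable0y_deriv dF cf f0 F0 Fy.
have [K K0 hK] := powR_le_expR (x + 1) c0.
apply: (integrable0y_le _ (integrable0yZ (K * expR c / x) fi)).
  move=> t t0; apply: cvgM.
  - by have /is_derive_continuous := is_derive_powR (x - 1) t0.
  - by have /is_derive_continuous := is_derive_expRM (- c) t.
move=> t t0; rewrite ger0_norm ?mulr_ge0 ?powR_ge0 ?expR_ge0//.
have t10 : 0 < 1 + t by rewrite addr_gt0.
have -> : K * expR c / x * f t = t `^ (x - 1) * (K * expR c / (1 + t) `^ (x + 1)).
  rewrite /f /V powRM ?(ltW t0) ?invr_ge0 ?(ltW t10)//.
  have -> : (1 + t)^-1 `^ (x - 1) = (1 + t) ^+ 2 / (1 + t) `^ (x + 1).
    rewrite -powR_inv1 ?(ltW t10)// -powRrM mulN1r -powR_mulrn ?(ltW t10)// -powRN.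
    by rewrite -powRD ?(gt_eqF t10) ?implybT//; congr powR; ring.
  field; rewrite !gt_eqF//=; exact: powR_gt0.
apply: ler_wpM2l; first exact: powR_ge0.
rewrite ler_pdivlMr ?powR_gt0//.
apply: (le_trans (ler_wpM2l (expR_ge0 _) (hK (1 + t) _))).
  by rewrite lerDl ltW.
rewrite mulrC -mulrA -expRD; apply: ler_wpM2l; first exact: ltW.
by rewrite ler_expR [leLHS](_ : _ = c)//; ring.
Unshelve. all: by end_near. Qed.

Lemma GammaE x : Gamma x = int0y (fun t => t `^ (x - 1) * expR (- 1 * t)).
Proof. by rewrite /Gamma; apply: eq_int0y => t t0; rewrite mulN1r. Qed.

Lemma continuous_GammaM p c t : 0 < t ->
  {for t, continuous (fun s => s `^ p * expR (c * s))}.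
Proof.
move=> t0; apply: cvgM.
- by have /is_derive_continuous := is_derive_powR p t0.
- by have /is_derive_continuous := is_derive_expRM c t.
Qed.

(** On [1, 2] the integrand is bounded below by a positive constant. *)
Lemma Gamma_gt0 x : 0 < x -> 0 < Gamma x.
Proof.
move=> x0; rewrite GammaE.
have fi := integrable0y_Gamma x0 (@ltr01 R).
set f := (fun t => _) in fi *.
have mD : measurable D0y by [].
rewrite -lte_fin -int0yE//.
have S12 : (`[1, 2]%classic : set R) `<=` D0y.
  by move=> t /=; rewrite !in_itv/= andbT => /andP[+ _]; exact: lt_le_trans.
have h : (\int[mu]_(t in (`[1%R, 2%R]%classic : set R)) (f t)%:E <=
    \int[mu]_(t in D0y) (f t)%:E)%E.
  apply: ge0_subset_integral => //.
  - exact: (measurable_int mu fi).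
  - by move=> t _; rewrite lee_fin mulr_ge0 ?powR_ge0 ?expR_ge0.
apply: lt_le_trans h.
pose k : R := expR (- `|x - 1|) * expR (- 1 * 2).
have k0 : 0 < k by rewrite mulr_gt0 ?expR_gt0.
apply: (@lt_le_trans _ _ (\int[mu]_(t in (`[1%R, 2%R]%classic : set R)) (cst k%:E t))%E).
  rewrite integral_cst//= lebesgue_measure_itv/= lte_fin ltr1n.
  by rewrite -EFinB -EFinM lte_fin mulr_gt0// subr_gt0 ltr1n.
apply: ge0_le_integral => //.
- by move=> t _; rewrite lee_fin ltW.
- apply: measurable_funS (measurable_int mu fi) => //.
- move=> t /=; rewrite in_itv/= => /andP[t1 t2]; rewrite lee_fin.
  have t0 : 0 < t by exact: lt_le_trans t1.
  apply: ler_pM; rewrite ?expR_ge0// ?ler_expR; last by rewrite !mulN1r lerN2.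
  rewrite /powR gt_eqF// ler_expR lerNl -mulNr.
  have l0 : 0 <= ln t by exact: ln_ge0.
  have l1 : ln t <= 1.
    rewrite -(expRK 1) ler_ln ?posrE ?expR_gt0//.
    by apply: (le_trans t2); have := expR_ge1Dx (1 : R).
  apply: (le_trans (ler_norm _)); rewrite normrM normrN (ger0_norm l0).
  by rewrite ler_piMr.
Qed.

Lemma cvg0_powR_expR p c : 0 < p -> 0 < c ->
  (fun t => t `^ p * expR (- c * t)) @ 0^'+ --> (0 : R) /\
  (fun t => t `^ p * expR (- c * t)) @ +oo --> (0 : R).
Proof.
move=> p0 c0; split.
- apply: (@squeeze_cvgr _ _ _ _ (fun=> 0) (fun t => t `^ p)).
  + near=> t; have t0 : 0 < t by near: t; exact: nbhs_right_gt.
    rewrite mulr_ge0 ?powR_ge0 ?expR_ge0//= ler_piMr ?powR_ge0//.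
    by rewrite -expR0 ler_expR mulNr oppr_le0 mulr_ge0 ?ltW.
  + exact: cvg_cst.
  + exact: powR_cvg0.
- have c20 : 0 < c / 2 by rewrite divr_gt0.
  have [K K0 hK] := powR_le_expR p c20.
  apply: (@cvg0_expR_bound _ K (c / 2)) => // t t1.
  rewrite ger0_norm ?mulr_ge0 ?powR_ge0 ?expR_ge0//.
  apply: (le_trans (ler_wpM2r (expR_ge0 _) (hK _ t1))).
  rewrite -(mulrA K) -expRD ler_wpM2l ?(ltW K0)// ler_expR.
  by rewrite [leLHS](_ : _ = - (c / 2) * t)//; field.
Unshelve. all: by end_near. Qed.

(** Integration by parts, the boundary terms being those of t ^ x exp (- t). *)
Lemma GammaD1 x : 0 < x -> Gamma (x + 1) = x * Gamma x.
Proof.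
move=> x0; rewrite !GammaE.
have i1 := integrable0y_Gamma x0 (@ltr01 R).
have x10 : 0 < x + 1 by rewrite addr_gt0.
have i2 := integrable0y_Gamma x10 (@ltr01 R).
rewrite -int0yZ//; apply/eqP; rewrite -subr_eq0; apply/eqP.
set f1 := (fun t => _) in i2 *; set f2 := fun t => x * _.
have if2 : integrable0y f2 by exact: integrable0yZ.
have -> : int0y f1 - int0y f2 = - int0y (fun t => f2 t + (-1) * f1 t).
  by rewrite int0yD ?int0yZ//; [ring|exact: integrable0yZ].
have [F0 Fy] := cvg0_powR_expR x0 (@ltr01 R).
suff -> : int0y (fun t => f2 t + (-1) * f1 t) = 0 - 0 by rewrite subr0 oppr0.
apply: (@int0y_deriv _ (fun t => t `^ x * expR (- 1 * t))) => //.
- move=> t t0; have d := is_deriveM (is_derive_powR x t0) (is_derive_expRM (-1) t).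
  apply: (is_derive_eq d); rewrite -![_ *: _]/(_ * _) /f1 /f2 addrK; ring.
- move=> t t0; apply: cvgD; apply: cvgM; try exact: cvg_cst; exact: continuous_GammaM.
- apply: integrable0yD => //; exact: integrable0yZ.
Qed.

End EulerGamma.

(** * A Bessel integral of order one half *)

Section Bessel.
Context {R : realType}.
Implicit Types (f g F G : R -> R) (a b c x y l s t w : R).
Local Notation mu := (@lebesgue_measure R).
Local Notation D0y := (`]0, +oo[%classic : set R).

(** Not normalized: the limit at infinity is the square root of pi. *)
Definition gauss_cdf x : R := \int[mu]_(t in `]-oo, x]) gauss_fun t.

Lemma gauss_integrableS (A : set R) : measurable A ->
  mu.-integrable A (EFin \o gauss_fun).
Proof. by move=> mA; apply: integrableS integrableT_gauss => //. Qed.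

Lemma is_derive_gauss_cdf x : is_derive x 1 gauss_cdf (gauss_fun x).
Proof.
have x1 : x < x + 1 by rewrite ltrDl.
have [|||d e] := @continuous_FTC1 R gauss_fun -oo%O x (x + 1) x1.
- exact: gauss_integrableS.
- by rewrite ltNyr.
- exact: continuous_gauss_fun.
by split; [exact: d|rewrite -derive1E; exact: e].
Qed.

(** Stated for sequences, and with A either everything or nothing it gives the
    limits at both ends. *)
Lemma cvg_gauss_cdf (u : nat -> R) (A : set R) : measurable A ->
  (forall t, \forall n \near \oo, (t <= u n) = (t \in A)) ->
  gauss_cdf (u n) @[n --> \oo] --> \int[mu]_(t in A) gauss_fun t.
Proof.
move=> mA uA.
have mT : measurable (setT : set R) by [].
have [|||||_ _] := @dominated_convergence _ _ _ mu setT mT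
   (fun n => (EFin \o gauss_fun) \_ (`]-oo, u n]%classic : set R))
   ((EFin \o gauss_fun) \_ A) (EFin \o gauss_fun).
- move=> n; apply/measurable_restrict => //; rewrite setTI.
  exact: measurable_int (gauss_integrableS _).
- apply/measurable_restrict => //; rewrite setTI.
  exact: measurable_int (gauss_integrableS _).
- apply/aeW => t _; apply: cvg_near_cst.
  have := uA t; apply: filterS => n e.
  by rewrite !patchE mem_setE in_itv/= e.
- exact: integrableT_gauss.
- apply/aeW => t n _; rewrite patchE; case: ifPn => _ /=.
    by rewrite ger0_norm// gauss_fun_ge0.
  by rewrite normr0 lee_fin gauss_fun_ge0.
rewrite -integral_mkcond => h.
apply: (@cvg_trans _ (fine (\int[mu]_(t in `]-oo, u n]) (gauss_fun t)%:E)%E @[n --> \oo])) => //.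
apply: fine_cvg.
rewrite fineK; last first.
  exact: (integrable_fin_num _ (gauss_integrableS mA)).
by under eq_fun do rewrite integral_mkcond.
Qed.

Lemma gauss_cdf_y : gauss_cdf x @[x --> +oo] --> Num.sqrt pi.
Proof.
apply/cvg_pinftyP => u uy.
have := @cvg_gauss_cdf u setT measurableT.
rewrite /Rintegral integralT_gauss/=; apply=> t.
move/cvgryPge : uy => /(_ t); apply: filterS => n ->.
by rewrite in_setT.
Qed.

Lemma gauss_cdf_Ny : gauss_cdf x @[x --> -oo] --> (0 : R).
Proof.
apply/cvg_ninftyP => u uy.
have := @cvg_gauss_cdf u set0 measurable0.
rewrite Rintegral_set0; apply=> t.
move/cvgrNyPlt : uy => /(_ t); apply: filterS => n h.
by rewrite in_set0 leNgt h.
Qed.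

Lemma cvg_sqrt_combination_0 w : 0 < w ->
  (Num.sqrt t - w / (2 * Num.sqrt t)) @[t --> 0^'+] --> -oo /\
  (Num.sqrt t + w / (2 * Num.sqrt t)) @[t --> 0^'+] --> +oo.
Proof.
move=> w0.
have key A : 0 < A -> \forall t \near 0^'+, Num.sqrt t <= 1 /\ A <= w / (2 * Num.sqrt t).
  move=> A0; near=> t.
  have t0 : 0 < t by near: t; exact: nbhs_right_gt.
  have s0 : 0 < Num.sqrt t by rewrite sqrtr_gt0.
  split.
    have t1 : t <= 1 by near: t; exact: nbhs_right_le.
    by rewrite -[leRHS]sqrtr1 ler_wsqrtr.
  rewrite ler_pdivlMr ?mulr_gt0// mulrA -ler_pdivlMl ?mulr_gt0//.
  have h : 0 <= (A * 2)^-1 * w.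
    by rewrite mulr_ge0 ?invr_ge0 ?mulr_ge0// ltW.
  have t1 : t <= ((A * 2)^-1 * w) ^+ 2.
    near: t; apply: nbhs_right_le.
    by rewrite exprn_gt0// mulr_gt0 ?invr_gt0 ?mulr_gt0.
  by rewrite -(ger0_norm h) -sqrtr_sqr ler_wsqrtr.
split.
- apply/cvgrNyPle => A.
  have := key (`|A| + 1) (ltr_wpDl (normr_ge0 _) ltr01).
  apply: filterS => t [h1 h2].
  have : - A <= `|A| by rewrite -normrN ler_norm.
  lra.
- apply/cvgryPge => A.
  have := key (`|A| + 1) (ltr_wpDl (normr_ge0 _) ltr01).
  apply: filterS => t [h1 h2].
  have : A <= `|A| by rewrite ler_norm.
  have : 0 <= Num.sqrt t by exact: sqrtr_ge0.
  lra.
Unshelve. all: by end_near. Qed.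

Lemma cvg_sqrt_combination_y w : 0 < w ->
  (Num.sqrt t - w / (2 * Num.sqrt t)) @[t --> +oo] --> +oo /\
  (Num.sqrt t + w / (2 * Num.sqrt t)) @[t --> +oo] --> +oo.
Proof.
move=> w0.
have key A : 0 < A -> \forall t \near +oo, A <= Num.sqrt t /\ 0 <= w / (2 * Num.sqrt t) <= w.
  move=> A0; near=> t.
  have t1 : 1 <= t by near: t; apply: nbhs_pinfty_ge; rewrite num_real.
  have s1 : 1 <= Num.sqrt t by rewrite -[leLHS]sqrtr1; rewrite ler_wsqrtr.
  have s0 : 0 < Num.sqrt t by exact: lt_le_trans s1.
  split; last first.
    apply/andP; split; first by rewrite divr_ge0 ?mulr_ge0// ltW.
    rewrite ler_pdivrMr ?mulr_gt0// ler_peMr ?(ltW w0)//; lra.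
  have tA : A ^+ 2 <= t by near: t; apply: nbhs_pinfty_ge; rewrite num_real.
  by rewrite -(ger0_norm (ltW A0)) -sqrtr_sqr ler_wsqrtr.
split; apply/cvgryPge => A.
- have := key (`|A| + w) (ltr_wpDl (normr_ge0 _) w0).
  apply: filterS => t [h1 /andP[h2 h3]].
  have : A <= `|A| by rewrite ler_norm.
  lra.
- have := key (`|A| + w) (ltr_wpDl (normr_ge0 _) w0).
  apply: filterS => t [h1 /andP[h2 h3]].
  have : A <= `|A| by rewrite ler_norm.
  lra.
Unshelve. all: by end_near. Qed.

(** Up to a factor, the integrand of the Bessel function K_(1/2), which is
    elementary. *)
Definition bessel_half w t : R := (Num.sqrt t)^-1 * expR (- t - w ^+ 2 / (4 * t)).

(** There is an explicit antiderivative: with the Gaussian antiderivative Phi, it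
    is exp (- w) Phi (m t) + exp w Phi (p t), where m t and p t are
    sqrt t - w / (2 sqrt t) and sqrt t + w / (2 sqrt t). At 0 these tend to -oo
    and +oo, and at infinity both tend to +oo. *)
Lemma int0y_bessel_half w : 0 < w ->
  integrable0y (bessel_half w) /\
  int0y (bessel_half w) = Num.sqrt pi * expR (- w).
Proof.
move=> w0.
pose m t := Num.sqrt t - w / (2 * Num.sqrt t).
pose p t := Num.sqrt t + w / (2 * Num.sqrt t).
pose F t := expR (- w) * gauss_cdf (m t) + expR w * gauss_cdf (p t).
have dF t : 0 < t -> is_derive t 1 F (bessel_half w t).
  move=> t0.
  have s0 : 0 < Num.sqrt t by rewrite sqrtr_gt0.
  have sn : Num.sqrt t != 0 by rewrite gt_eqF.
  have sn2 : (2 : R) * Num.sqrt t != 0 by rewrite mulf_neq0.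
  have ds := is_derive1_sqrt t0.
  have d2 := @is_deriveZ _ _ _ (@Num.sqrt R) 2 t 1 _ ds.
  have d3 := @is_deriveV _ (fun t => 2 * Num.sqrt t) t _ 1 sn2 d2.
  have d4 := @is_deriveZ _ _ _ _ w t 1 _ d3.
  have dp : is_derive t 1 p _ := is_deriveD ds d4.
  have dm : is_derive t 1 m _ := is_deriveB ds d4.
  have dcp := is_derive1_comp (is_derive_gauss_cdf (p t)) dp.
  have dcm := is_derive1_comp (is_derive_gauss_cdf (m t)) dm.
  have dF : is_derive t 1 F _ :=
    is_deriveD (@is_deriveZ _ _ _ _ (expR (- w)) t 1 _ dcm)
               (@is_deriveZ _ _ _ _ (expR w) t 1 _ dcp).
  apply: (is_derive_eq dF).
  rewrite -![_ *: _]/(_ * _) /bessel_half /gauss_fun.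
  have e1 : expR (- w) * expR (- m t ^+ 2) = expR (- t - w ^+ 2 / (4 * t)).
    rewrite -expRD; congr expR; rewrite /m -{3 4}(sqr_sqrtr (ltW t0)).
    by field.
  have e2 : expR w * expR (- p t ^+ 2) = expR (- t - w ^+ 2 / (4 * t)).
    rewrite -expRD; congr expR; rewrite /p -{3 4}(sqr_sqrtr (ltW t0)).
    by field.
  rewrite !mulrA e1 e2 -mulrDr mulrC; congr (_ * _).
  by field.
have cf t : 0 < t -> {for t, continuous (bessel_half w)}.
  move=> t0.
  have s0 : Num.sqrt t != 0 by rewrite gt_eqF// sqrtr_gt0.
  apply: cvgM; first by apply: cvgV => //; exact: sqrt_continuous.
  apply: (@cvg_comp _ _ _ (fun t => - t - w ^+ 2 / (4 * t)) expR); last exact: continuous_expR.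
  apply: cvgB; first by apply: cvgN; exact: cvg_id.
  apply: cvgM; first exact: cvg_cst.
  apply: cvgV; first by rewrite mulf_neq0// gt_eqF.
  by apply: cvgM; [exact: cvg_cst|exact: cvg_id].
have f0 t : 0 < t -> 0 <= bessel_half w t.
  by move=> _; rewrite mulr_ge0 ?expR_ge0 ?invr_ge0 ?sqrtr_ge0.
have [m0 p0] := cvg_sqrt_combination_0 w0.
have [my py] := cvg_sqrt_combination_y w0.
have F0 : F t @[t --> 0^'+] --> expR (- w) * 0 + expR w * Num.sqrt pi.
  apply: cvgD; (apply: cvgM; first exact: cvg_cst).
    exact: (cvg_comp _ _ m0 gauss_cdf_Ny).
  exact: (cvg_comp _ _ p0 gauss_cdf_y).
have Fy : F t @[t --> +oo] --> expR (- w) * Num.sqrt pi + expR w * Num.sqrt pi.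
  apply: cvgD; (apply: cvgM; first exact: cvg_cst).
    exact: (cvg_comp _ _ my gauss_cdf_y).
  exact: (cvg_comp _ _ py gauss_cdf_y).
have fi := integrable0y_deriv dF cf f0 F0 Fy.
split => //; rewrite (int0y_deriv dF cf fi F0 Fy); ring.
Qed.

End Bessel.

(** * Exchange of integrals and scaling on the half-line *)

Section Fubini0y.
Context {R : realType}.
Implicit Types (f g h F G : R -> R) (a b c x y l s t w : R).
Local Notation mu := (@lebesgue_measure R).
Local Notation D0y := (`]0, +oo[%classic : set R).

Lemma integral0y_indic (f : R -> R) :
  (\int[mu]_(x in D0y) (f x)%:E = \int[mu]_x (f x * \1_D0y x)%:E)%E.
Proof.
rewrite integral_mkcond; apply: eq_integral => x _.
rewrite patchE indicE; case: ifPn => _; first by rewrite mulr1.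
by rewrite mulr0.
Qed.

(** Fubini's theorems are about functions on the whole plane; restricting to the
    quadrant by indicators keeps joint measurability. *)
Lemma measurable_quadrant (K : R -> R -> R) :
  measurable_fun setT (fun z : R * R => K z.1 z.2) ->
  measurable_fun setT (fun z : R * R => (K z.1 z.2 * \1_D0y z.1 * \1_D0y z.2)%:E).
Proof.
move=> mK; apply/measurable_EFinP.
have m1 : measurable_fun setT (\1_D0y : R -> R) by exact: measurable_indic.
apply: measurable_funM; first apply: measurable_funM => //.
- exact: (measurableT_comp m1 measurable_fst).
- exact: (measurableT_comp m1 measurable_snd).
Qed.

Lemma tonelli0y (K : R -> R -> R) :
  measurable_fun setT (fun z : R * R => K z.1 z.2) ->
  (forall x y, 0 < x -> 0 < y -> 0 <= K x y) ->
  (\int[mu]_(x in D0y) \int[mu]_(y in D0y) (K x y)%:E =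
   \int[mu]_(y in D0y) \int[mu]_(x in D0y) (K x y)%:E)%E.
Proof.
move=> mK K0.
have := @fubini_tonelli _ _ _ _ R mu mu
  (fun z : R * R => (K z.1 z.2 * \1_D0y z.1 * \1_D0y z.2)%:E) (measurable_quadrant mK).
have -> : (\int[mu]_(x in D0y) \int[mu]_(y in D0y) (K x y)%:E =
    \int[mu]_x \int[mu]_y (K x y * \1_D0y x * \1_D0y y)%:E)%E.
  rewrite integral_mkcond; apply: eq_integral => x _.
  rewrite patchE indicE; case: ifPn => _.
    by rewrite integral0y_indic; apply: eq_integral => y _; rewrite mulr1.
  by rewrite integral0_eq// => y _; rewrite mulr0 mul0r.
have -> : (\int[mu]_(y in D0y) \int[mu]_(x in D0y) (K x y)%:E =
    \int[mu]_y \int[mu]_x (K x y * \1_D0y x * \1_D0y y)%:E)%E.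
  rewrite integral_mkcond; apply: eq_integral => y _.
  rewrite patchE [in RHS]indicE; case: ifPn => _.
    by rewrite integral0y_indic; apply: eq_integral => x _; rewrite mulr1.
  by rewrite integral0_eq// => x _; rewrite mulr0.
apply=> -[x y] /=; rewrite lee_fin !indicE.
case: (boolP (x \in D0y)) => [/[!inE] /itv0y_gt0 x0|_]; last by rewrite mulr0 mul0r.
case: (boolP (y \in D0y)) => [/[!inE] /itv0y_gt0 y0|_]; last by rewrite mulr0.
by rewrite !mulr1 K0.
Qed.

(** A product bound makes the absolute double integral finite. *)
Lemma fubini0y (K : R -> R -> R) g h :
  measurable_fun setT (fun z : R * R => K z.1 z.2) ->
  integrable0y g -> integrable0y h ->
  (forall x y, 0 < x -> 0 < y -> `|K x y| <= g x * h y) ->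
  int0y (fun x => int0y (K x)) = int0y (fun y => int0y (K ^~ y)).
Proof.
move=> mK gi hi Kgh.
have mf := measurable_quadrant mK.
set f := (fun z : R * R => _) in mf.
have mKx x : measurable_fun setT (K x).
  exact: (measurableT_comp mK (pair1_measurable x)).
have mKy y : measurable_fun setT (K ^~ y).
  exact: (measurableT_comp mK (pair2_measurable y)).
have mD : measurable D0y by [].
have iKx x : 0 < x -> integrable0y (K x).
  move=> x0; apply: (le_integrable _ _ _ (integrable0yZ (g x) hi)) => //.
    by apply/measurable_EFinP; exact: measurable_funS (mKx x).
  move=> y /itv0y_gt0 y0; rewrite lee_fin (le_trans (Kgh _ _ x0 y0))//=.
  exact: ler_norm.
have iKy y : 0 < y -> integrable0y (K ^~ y).
  move=> y0; apply: (le_integrable _ _ _ (integrable0yZ (h y) gi)) => //.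
    by apply/measurable_EFinP; exact: measurable_funS (mKy y).
  move=> x /itv0y_gt0 x0; rewrite lee_fin (le_trans (Kgh _ _ x0 y0))//=.
  by rewrite mulrC ler_norm.
have fi : ((mu \x mu)%E).-integrable setT f.
  apply/integrable12ltyP => //.
  apply: (@le_lt_trans _ _ (\int[mu]_(x in D0y) (`|g x| * int0y (fun y => `|h y|))%:E)%E).
    rewrite [leRHS]integral_mkcond; apply: ge0_le_integral => //.
    - by move=> x _; exact: integral_ge0.
    - have maf : measurable_fun setT (abse \o f) by exact: measurableT_comp.
      exact: (@measurable_fun_fubini_tonelli_F _ _ _ _ R mu (abse \o f) maf
        (fun z => abse_ge0 (f z))).
    - apply/measurable_restrict => //; rewrite setTI; apply/measurable_EFinP.
      apply: measurable_funM => //; apply: measurableT_comp => //.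
      by apply/measurable_EFinP; exact: measurable_int gi.
    move=> x _; rewrite patchE; case: ifPn => [/[!inE] xD|xD]; last first.
      rewrite integral0_eq// => y _.
      by rewrite /f /= indicE (negbTE xD) mulr0 mul0r normr0.
    have x0 := itv0y_gt0 xD.
    rewrite EFinM -int0yE; last exact: (integrable_norm hi).
    rewrite -ge0_integralZl//; last first.
      by apply/measurable_EFinP; apply: measurableT_comp => //;
        apply/measurable_EFinP; exact: measurable_int hi.
    rewrite [leRHS]integral_mkcond; apply: ge0_le_integral => //.
    - by apply: measurableT_comp => //; exact: (measurableT_comp mf (pair1_measurable x)).
    - apply/measurable_restrict => //; rewrite setTI; apply: measurable_funeM.
      by apply/measurable_EFinP; apply: measurableT_comp => //;
        apply/measurable_EFinP; exact: measurable_int hi.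
    move=> y _; rewrite patchE /f /= [\1__ x]indicE mem_set// mulr1 indicE.
    case: ifPn => [/[!inE] yD|_]; last by rewrite mulr0 normr0.
    rewrite mulr1 -EFinM lee_fin (le_trans (Kgh _ _ x0 (itv0y_gt0 yD)))//.
    by rewrite (le_trans (ler_norm _))// normrM.
  set c := int0y _.
  have ig : integrable0y (fun x => c * `|g x|).
    exact: integrable0yZ (integrable_norm gi).
  have c0 : 0 <= c by exact: Rintegral_ge0.
  have : (\int[mu]_(x in D0y) (c * `|g x|)%:E)%E \is a fin_num.
    exact: integrable_fin_num ig.
  rewrite ge0_fin_numE; first by under eq_integral do rewrite mulrC.
  by apply: integral_ge0 => x _; rewrite lee_fin mulr_ge0.
have := @Fubini _ _ _ _ R mu mu f fi.
have -> : (\int[mu]_x \int[mu]_y f (x, y) = \int[mu]_(x in D0y) (int0y (K x))%:E)%E.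
  rewrite [RHS]integral_mkcond; apply: eq_integral => x _.
  rewrite patchE /f /= [\1__ x]indicE; case: ifPn => [/[!inE] xD|_].
    rewrite -int0yE ?integral0y_indic; last exact/iKx/itv0y_gt0.
    by apply: eq_integral => y _; rewrite mulr1.
  by rewrite integral0_eq// => y _; rewrite mulr0 mul0r.
have -> : (\int[mu]_y \int[mu]_x f (x, y) = \int[mu]_(y in D0y) (int0y (K ^~ y))%:E)%E.
  rewrite [RHS]integral_mkcond; apply: eq_integral => y _.
  rewrite patchE /f /= [\1__ y]indicE; case: ifPn => [/[!inE] yD|_].
    rewrite -int0yE ?integral0y_indic; last exact/iKy/itv0y_gt0.
    by apply: eq_integral => x _; rewrite mulr1.
  by rewrite integral0_eq// => x _; rewrite mulr0.
by rewrite /int0y /Rintegral => ->.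
Qed.

(** Change of variable t = c x, in the extended reals so that it can be used
    under Tonelli's theorem. *)
Lemma integral0y_scale f c : 0 < c -> {within `[0, +oo[, continuous f} ->
  (forall x, 0 < x -> 0 <= f x) ->
  (\int[mu]_(x in D0y) (f x)%:E = \int[mu]_(x in D0y) (c * f (c * x))%:E)%E.
Proof.
move=> c0 cf f0.
have /continuous_within_itvcyP[cf1 cf0] := cf.
have d x : is_derive x 1 (fun x : R => c * x) c.
  have h := @is_deriveZ _ _ _ (@id R) c x 1 _ (is_derive_id x 1).
  by apply: (is_derive_eq h); rewrite -![_ *: _]/(_ * _) mulr1.
have dE : (fun x : R => c * x)^`()%classic = cst c.
  by apply/funext => x; rewrite derive1E; have [_] := d x.
have := @increasing_ge0_integration_by_substitutiony R (fun x => c * x) f 0.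
rewrite mulr0 dE => H.
rewrite [LHS]integral_itv_obnd_cbnd; last first.
  apply/measurable_EFinP; apply: open_continuous_measurable_fun => // x.
  by rewrite inE/= => h; exact: cf1.
rewrite H => //.
- rewrite -[LHS]integral_itv_obnd_cbnd; last first.
    apply/measurable_EFinP; apply: open_continuous_measurable_fun => // x.
    rewrite inE/= in_itv/= andbT => x0.
    apply: cvgM; last exact: cvg_cst.
    apply: continuous_comp; last by apply: cf1; rewrite in_itv/= mulr_gt0.
    exact: is_derive_continuous (d x).
  by apply: eq_integral => x _; rewrite /= fctE /= mulrC.
- by move=> x y _ _ xy; rewrite ltr_pM2l.
- by move=> x _; exact: cvg_cst.
- exact: is_cvg_cst.
- exact: is_cvg_cst.
- split; first by move=> x _; have [] := d x.
  apply: cvg_at_right_filter; exact: is_derive_continuous (d 0).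
- apply: gt0_cvgMry => //; exact: cvg_id.
- by move=> x; rewrite in_itv/= andbT => /f0.
Qed.

End Fubini0y.

(** * Gaussian moments *)

Section Duplication.
Context {R : realType}.
Implicit Types (f g h F G : R -> R) (a b c p x y l s t w : R).
Local Notation mu := (@lebesgue_measure R).
Local Notation D0y := (`]0, +oo[%classic : set R).

(** The integrand of the moment of order p - 1 of the weight exp (- t ^ 2 / 4). *)
Definition gauss_moment p t : R := t `^ (p - 1) * expR (- (t ^+ 2 / 4)).

Lemma gauss_moment_ge0 p t : 0 <= gauss_moment p t.
Proof. by rewrite mulr_ge0 ?powR_ge0 ?expR_ge0. Qed.

Lemma continuous_gauss_moment p t : 0 < t -> {for t, continuous (gauss_moment p)}.
Proof.
move=> t0; apply: cvgM; first by have /is_derive_continuous := is_derive_powR (p - 1) t0.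
apply: (@cvg_comp _ _ _ (fun t => - (t ^+ 2 / 4)) expR); last exact: continuous_expR.
apply: cvgN; apply: cvgM; last exact: cvg_cst.
exact: exprn_continuous.
Qed.

Lemma integrable0y_gauss_moment p : 0 < p -> integrable0y (gauss_moment p).
Proof.
move=> p0.
apply: (integrable0y_le _ (integrable0yZ (expR 1) (integrable0y_Gamma p0 (@ltr01 R)))).
  exact: continuous_gauss_moment.
move=> t t0; rewrite ger0_norm ?gauss_moment_ge0// mulrCA -expRD.
apply: ler_wpM2l; first exact: powR_ge0.
rewrite ler_expR; have := sqr_ge0 (t - 2); nra.
Qed.

Lemma continuous_gauss_moment_closed p : 1 < p ->
  {within `[0, +oo[, continuous (gauss_moment p)}.
Proof.
move=> p1; have p10 : 0 < p - 1 by rewrite subr_gt0.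
apply/continuous_within_itvcyP; split.
  by move=> x; rewrite in_itv/= andbT => x0; exact: continuous_gauss_moment.
apply: cvgM; first by rewrite powR0 ?gt_eqF//; exact: powR_cvg0.
apply: cvg_at_right_filter.
apply: (@cvg_comp _ _ _ (fun t => - (t ^+ 2 / 4)) expR); last exact: continuous_expR.
apply: cvgN; apply: cvgM; last exact: cvg_cst.
exact: exprn_continuous.
Qed.

(** The kernel w ^ (p - 1) [bessel_half w t], with powers in place of the
    inverses for the sake of measurability. *)
Let K p t w : R :=
  w `^ (p - 1) * (t `^ (- 2^-1) * expR (- t - w ^+ 2 / 4 * t `^ (- 1))).

Let KE p t w : 0 < t -> K p t w = w `^ (p - 1) * bessel_half w t.
Proof.
move=> t0; rewrite /K /bessel_half powRN powR12_sqrt ?(ltW t0)// powR_inv1 ?(ltW t0)//.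
by congr (_ * (_ * expR (_ - _))); field; rewrite gt_eqF.
Qed.

Let measurable_K p : measurable_fun setT (fun z : R * R => K p z.1 z.2).
Proof.
have mp q (f : R * R -> R) : measurable_fun setT f ->
    measurable_fun setT (fun z => f z `^ q).
  by move=> mf; exact: (measurableT_comp (measurable_powR q) mf).
apply: measurable_funM; first exact: (mp _ snd).
apply: measurable_funM; first exact: (mp _ fst).
apply: measurableT_comp => //; apply: measurable_funB.
  exact: measurableT_comp.
apply: measurable_funM; last exact: (mp _ fst).
by apply: measurable_funM => //; apply: measurable_funX.
Qed.

(** Write the left-hand side as a double integral over t (from Gamma b) and over
    the moment variable, and scale the latter by 1 / sqrt t. Then all powers of t
    combine into those of [bessel_half], and exchanging the integrals leaves
    Euler's integral for Gamma (2 b - 1). *)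
Lemma Gamma_gauss_moment b : 1 < b ->
  Gamma b * int0y (gauss_moment (2 * b - 1)) = Num.sqrt pi * Gamma (2 * b - 1).
Proof.
move=> b1; set p := 2 * b - 1.
have p1 : 1 < p by rewrite /p; lra.
have p0 : 0 < p by exact: lt_trans p1.
have b0 : 0 < b by exact: lt_trans b1.
have ib := integrable0y_Gamma b0 (@ltr01 R).
have ip := integrable0y_Gamma p0 (@ltr01 R).
have im := integrable0y_gauss_moment p0.
apply: EFin_inj.
transitivity (\int[mu]_(t in D0y) \int[mu]_(w in D0y) (K p t w)%:E)%E.
  rewrite GammaE -[LHS]/(_ : \bar R).
  rewrite mulrC -int0yZ// -int0yE; last exact: integrable0yZ.
  apply: eq_integral => t /[!inE] /itv0y_gt0 t0.
  have s0 : 0 < (Num.sqrt t)^-1 by rewrite invr_gt0 sqrtr_gt0.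
  rewrite mulrC EFinM -int0yE//.
  rewrite (integral0y_scale s0 (continuous_gauss_moment_closed p1)); last first.
    by move=> x _; exact: gauss_moment_ge0.
  rewrite -ge0_integralZl//; last 3 first.
  - apply/measurable_EFinP; apply: open_continuous_measurable_fun => // x.
    rewrite inE/= in_itv/= andbT => x0.
    apply: cvgM; first exact: cvg_cst.
    apply: continuous_comp.
      by apply: cvgM; [exact: cvg_cst|exact: cvg_id].
    by apply: continuous_gauss_moment; rewrite mulr_gt0.
  - by move=> x _; rewrite lee_fin mulr_ge0 ?gauss_moment_ge0// ltW.
  - by rewrite lee_fin mulr_ge0 ?powR_ge0 ?expR_ge0.
  apply: eq_integral => w /[!inE] /itv0y_gt0 w0.
  rewrite -EFinM KE//; congr EFin.
  rewrite /gauss_moment /bessel_half powRM ?(ltW w0) ?(ltW s0)//.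
  have -> : (Num.sqrt t)^-1 `^ (p - 1) = (t `^ (b - 1))^-1.
    rewrite -(powRN t (b - 1)) -powR12_sqrt ?(ltW t0)// -(powRN t 2^-1) -powRrM.
    by congr powR; rewrite /p; field.
  have tb : t `^ (b - 1) != 0 by rewrite gt_eqF// powR_gt0.
  have -> : expR (- t - w ^+ 2 / (4 * t)) =
      expR (- 1 * t) * expR (- (((Num.sqrt t)^-1 * w) ^+ 2 / 4)).
    rewrite -expRD exprMn exprVn sqr_sqrtr ?(ltW t0)//.
    by congr expR; field; rewrite gt_eqF.
  by field; rewrite tb gt_eqF// sqrtr_gt0.
rewrite (tonelli0y (measurable_K p)); last first.
  by move=> t w _ _; rewrite mulr_ge0 ?powR_ge0// mulr_ge0 ?powR_ge0 ?expR_ge0.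
rewrite GammaE -int0yZ// -int0yE; last exact: integrable0yZ.
apply: eq_integral => w /[!inE] /itv0y_gt0 w0.
have [iB eB] := int0y_bessel_half w0.
transitivity (\int[mu]_(t in D0y) (w `^ (p - 1) * bessel_half w t)%:E)%E.
  by apply: eq_integral => t /[!inE] /itv0y_gt0 t0; rewrite KE.
rewrite int0yE; last exact: integrable0yZ.
by rewrite int0yZ// eB; congr EFin; rewrite mulN1r; ring.
Qed.

End Duplication.

(** * Integrals over vertical lines *)

Section Contour.
Local Open Scope complex_scope.
Local Open Scope ring_scope.
Context {R : realType}.
Implicit Types (f g df : R[i] -> R[i]) (a b c p q x y l s t u v : R) (z w : R[i]).
Import Normc.
Local Notation mu := (@lebesgue_measure R).
Local Notation D0y := (`]0, +oo[%classic : set R).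
Local Notation Re := complex.Re.
Local Notation Im := complex.Im.

Definition vline c y : R[i] := c%:C + y%:C * 'i%C.

Lemma Re_vline c y : Re (vline c y) = c.
Proof. by rewrite /vline /=; ring. Qed.

Lemma Im_vline c y : Im (vline c y) = y.
Proof. by rewrite /vline /=; ring. Qed.

Lemma vlineE c y : vline c y = c +i* y.
Proof. by apply/eqP; rewrite eq_complex Re_vline Im_vline !eqxx. Qed.

Lemma cderiv_vline_y c y : cderiv (vline c) y 'i%C.
Proof. exact: cderiv_line. Qed.

Lemma cderiv_vline_c c y : cderiv (vline ^~ y) c 1.
Proof.
have h : cderiv (fun t : R => t%:C) c 1%:C by apply: cderiv_real; exact: is_derive_id.
by apply: (cderiv_eq (cderivD h (cderiv_cst _ c))); rewrite addr0.
Qed.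

(** A complex derivative is only used through the chain rule along curves, so
    that rule serves as its definition; it contains the Cauchy-Riemann equations,
    by comparing the horizontal and the vertical lines through a point. *)
Definition holo f df z := forall (k : R -> R[i]) x w,
  k x = z -> cderiv k x w -> cderiv (fun t => f (k t)) x (df z * w).

Lemma holo_cst w z : holo (fun=> w) (fun=> 0) z.
Proof. by move=> k x d _ _; rewrite mul0r; exact: cderiv_cst. Qed.

Lemma holo_id z : holo id (fun=> 1) z.
Proof. by move=> k x d _ h; rewrite mul1r. Qed.

Lemma holoD f df g dg z : holo f df z -> holo g dg z ->
  holo (fun z => f z + g z) (fun z => df z + dg z) z.
Proof.
by move=> hf hg k x w kx kw; rewrite mulrDl; apply: cderivD; [exact: hf|exact: hg].
Qed.

Lemma holoM f df g dg z : holo f df z -> holo g dg z ->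
  holo (fun z => f z * g z) (fun z => df z * g z + f z * dg z) z.
Proof.
move=> hf hg k x w kx kw.
by apply: (cderiv_eq (cderivM (hf _ _ _ kx kw) (hg _ _ _ kx kw))); rewrite kx; ring.
Qed.

Lemma holoV f df z : f z != 0 -> holo f df z ->
  holo (fun z => (f z)^-1) (fun z => - df z / f z ^+ 2) z.
Proof.
move=> fz0 hf k x w kx kw.
have kn : f (k x) != 0 by rewrite kx.
by apply: (cderiv_eq (cderivV kn (hf _ _ _ kx kw))); rewrite kx; ring.
Qed.

Lemma holo_exp f df z : holo f df z ->
  holo (fun z => cexp (f z)) (fun z => df z * cexp (f z)) z.
Proof.
move=> hf k x w kx kw.
by apply: (cderiv_eq (cderiv_exp (hf _ _ _ kx kw))); rewrite kx; ring.
Qed.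

Lemma holo_pow p z : 0 < Re z ->
  holo (fun z => cpow z p) (fun z => p%:C * cpow z (p - 1)) z.
Proof.
move=> z0 k x w kx kw.
have k0 : 0 < Re (k x) by rewrite kx.
by apply: (cderiv_eq (cderiv_pow p k0 kw)); rewrite kx.
Qed.

(** Cauchy's theorem for a strip. The integrals run over the upper half of each
    line only; the end on the real axis contributes nothing because f is real
    there. *)
Lemma contour_shift f df u v a b K :
  u < a < v -> u < b < v ->
  (forall z, u < Re z < v -> holo f df z) ->
  (forall s y, u < s < v -> 0 < y -> cdiff (fun t => df (vline s t)) y) ->
  (forall s, u < s < v -> Im (f (vline s 0)) = 0) ->
  0 <= K ->
  (forall s y, u < s < v -> 0 < y -> normc (f (vline s y)) <= K * expR (- 1 * y)) ->
  (forall s y, u < s < v -> 0 < y -> normc (df (vline s y)) <= K * expR (- 1 * y)) ->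
  int0y (fun y => Re (f (vline a y))) = int0y (fun y => Re (f (vline b y))).
Proof.
move=> ha hb hf cdf f0 K0 fK dfK.
have hcl s y : u < s < v -> u < Re (vline s y) < v by rewrite Re_vline.
have df_y s y : u < s < v -> cderiv (fun t => f (vline s t)) y (df (vline s y) * 'i%C).
  by move=> hs; apply: (hf _ (hcl s y hs)) => //; exact: cderiv_vline_y.
have df_c s y : u < s < v -> cderiv (fun t => f (vline t y)) s (df (vline s y) * 1).
  by move=> hs; apply: (hf _ (hcl s y hs) (fun t => vline t y)) => //; exact: cderiv_vline_c.
have iE : integrable0y (fun y => K * expR (- 1 * y)).
  apply: integrable0yZ; apply: eq_integrable0y (integrable0y_Gamma (@ltr01 R) (@ltr01 R)).
  by move=> t t0; rewrite subrr powRr0 mul1r.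
apply: (@int0y_param_const _ (fun s y => Re (f (vline s y))) (fun s y => Im (f (vline s y)))
   (fun s y => Re (df (vline s y))) (fun y => K * expR (- 1 * y)) u v a b ha hb).
- move=> s hs; apply: (integrable0y_le _ iE).
    by move=> y _; apply: cdiff_continuous_Re; eexists; exact: df_y.
  by move=> y y0; apply: le_trans (ler_normc_Re _) (fK _ _ hs y0).
- move=> s y hs y0; have [h _] := df_c s y hs.
  by move: h; rewrite mulr1.
- move=> s y hs y0; have [_ h] := df_y s y hs.
  by move: h; rewrite ImiRe.
- by move=> s y hs y0; apply: cdiff_continuous_Re; exact: cdf.
- by move=> y; rewrite mulr_ge0 ?expR_ge0.
- exact: iE.
- by move=> s y hs y0; apply: le_trans (ler_normc_Re _) (dfK _ _ hs y0).
- move=> s hs; apply: cvg_at_right_filter.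
  suff : Im (f (vline s y)) @[y --> (0 : R)] --> Im (f (vline s 0)) by rewrite f0.
  exact: is_derive_continuous (df_y s 0 hs).2.
- move=> s hs; apply: (@cvg0_expR_bound _ _ K 1) => // y y1.
  by apply: le_trans (ler_normc_Im _) (fK _ _ hs _); exact: lt_le_trans y1.
Qed.

Lemma normc_vline_sqr c y : normc (vline c y) ^+ 2 = c ^+ 2 + y ^+ 2.
Proof. by rewrite normc_sqr Re_vline Im_vline. Qed.

Lemma Re_vline_sqr c y : Re (vline c y ^+ 2) = c ^+ 2 - y ^+ 2.
Proof. by rewrite vlineE expr2 /=; ring. Qed.

Lemma normc_vline_ge c y : 0 <= c -> c <= normc (vline c y).
Proof.
by move=> c0; rewrite -{1}(Re_vline c y) (le_trans (ler_norm _))// ler_normc_Re.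
Qed.

Lemma expR_gauss_le (y : R) : expR (- (y ^+ 2 / 2)) <= expR 2^-1 * expR (- 1 * y).
Proof. by rewrite -expRD ler_expR; have := sqr_ge0 (y - 1); lra. Qed.

(** The bound is uniform in the exponent, which is what makes the later
    estimates uniform in alpha; |z| >= 1 on these lines, so that larger
    exponents dominate. *)
Lemma gauss_pow_bound M Q : exists2 K, 0 < K & forall c y q, 1 <= c <= M -> q <= Q ->
  expR (c ^+ 2 - y ^+ 2) * normc (vline c y) `^ q <= K * expR (- 1 * y).
Proof.
have h2 : (0 : R) < 2^-1 by rewrite invr_gt0.
have [K K0 hK] := powR_le_expR (Q / 2) h2.
exists (K * expR (3 / 2 * M ^+ 2) * expR 2^-1).
  by rewrite !mulr_gt0 ?expR_gt0.
move=> c y q /andP[c1 cM] qQ.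
have n1 : 1 <= normc (vline c y).
  by apply: (le_trans c1); apply: normc_vline_ge; apply: le_trans c1.
have n0 : 0 <= normc (vline c y) by exact: normc_ge0.
have c0 : 0 <= c by exact: le_trans c1.
have cM2 : c ^+ 2 <= M ^+ 2.
  by rewrite ler_sqr ?nnegrE//; exact: le_trans cM.
have h : normc (vline c y) `^ q <= K * expR (2^-1 * (c ^+ 2 + y ^+ 2)).
  apply: (le_trans (ler_powR n1 qQ)).
  have -> : normc (vline c y) `^ Q = (c ^+ 2 + y ^+ 2) `^ (Q / 2).
    by rewrite -normc_vline_sqr -powR_mulrn// -powRrM; congr powR; field.
  by apply: hK; rewrite -normc_vline_sqr expr_ge1.
apply: (le_trans (ler_wpM2l (expR_ge0 _) h)).
rewrite mulrCA -mulrA -mulrA; apply: ler_wpM2l; first exact: ltW.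
apply: (@le_trans _ _ (expR (3 / 2 * M ^+ 2) * expR (- (y ^+ 2 / 2)))).
  by rewrite -!expRD ler_expR; lra.
by apply: ler_wpM2l; [exact: expR_ge0|exact: expR_gauss_le].
Qed.

(** By a contour shift to the imaginary axis, where the integrand is the real
    Gaussian function. *)
Lemma int0y_gauss_line c :
  int0y (fun y => Re (cexp (vline c y ^+ 2))) = Num.sqrt pi / 2.
Proof.
pose M := `|c| + 1.
have cM : - M < c < M.
  rewrite /M; apply/andP; split; last by rewrite ltr_pwDr// ler_norm.
  by rewrite ltrNl ltr_pwDr// -normrN ler_norm.
have M0 : 0 < M by rewrite ltr_wpDl.
have sM s : - M < s < M -> s ^+ 2 <= M ^+ 2.
  move=> /andP[h1 h2].
  have : 0 <= (M - s) * (M + s) by rewrite mulr_ge0//; lra.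
  by rewrite -subr_sqr subr_ge0.
have -> : int0y (fun y => Re (cexp (vline c y ^+ 2))) =
    int0y (fun y => Re (cexp (vline 0 y ^+ 2))).
  pose K := 2 * (M + 1) * expR (M ^+ 2 + 1).
  have M1 : 1 <= M + 1 by rewrite lerDr ltW.
  have bnd s y : - M < s < M -> 0 < y ->
      normc (cexp (vline s y * vline s y)) <= expR (M ^+ 2 + 1) * expR (- (2 * y)).
    move=> hs y0; rewrite -expr2 normc_exp Re_vline_sqr -!expRD ler_expR.
    have := sM s hs; have := sqr_ge0 (y - 1).
    by rewrite sqrrB; lra.
  have E s y : - M < s < M -> 0 < y ->
      normc (vline s y) <= (M + 1) * expR y.
    move=> hs y0.
    have n : normc (vline s y) <= M + y.
      rewrite -(@ler_pXn2r _ 2) ?nnegrE ?normc_ge0 ?addr_ge0 ?(ltW M0) ?(ltW y0)//.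
      rewrite normc_vline_sqr sqrrD; have := sM s hs; have : 0 <= M * y by rewrite mulr_ge0 ?ltW.
      by lra.
    apply: (le_trans n); have := expR_ge1Dx y.
    have : 0 <= M * y by rewrite mulr_ge0 ?ltW.
    have : 1 <= expR y by rewrite -expR0 ler_expR ltW.
    by nra.
  apply: (@contour_shift (fun z => cexp (z ^+ 2)) (fun z => (1 * z + z * 1) * cexp (z * z))
    (- M) M c 0 K) => //.
  - by rewrite oppr_lt0 M0.
  - move=> z _; rewrite (_ : (fun _ => _) = (fun z => cexp (z * z))).
      by apply: holo_exp; apply: holoM; exact: holo_id.
    by apply/funext => ?; rewrite expr2.
  - move=> s y _ _; have cy : cdiff (vline s) y by eexists; exact: cderiv_vline_y.
    apply: cdiffM.
      by apply: cdiffD; apply: cdiffM => //; exact: cdiff_cst.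
    by apply: cdiff_exp; exact: cdiffM.
  - by move=> s _; rewrite vlineE expr2 /= !mulr0 mul0r addr0 sin0 mulr0.
  - by rewrite !mulr_ge0 ?expR_ge0// ltW// ltr_wpDr.
  - move=> s y hs y0; rewrite expr2; apply: (le_trans (bnd s y hs y0)).
    rewrite /K -(mulrA (2 * (M + 1))).
    apply: (@le_trans _ _ (1 * (expR (M ^+ 2 + 1) * expR (- 1 * y)))).
      by rewrite mul1r; apply: ler_wpM2l; rewrite ?expR_ge0// ler_expR; lra.
    by apply: ler_wpM2r; [rewrite mulr_ge0 ?expR_ge0|lra].
  - move=> s y hs y0; rewrite normcM.
    have -> : 1 * vline s y + vline s y * 1 = vline s y *+ 2 by rewrite mulr2n mul1r mulr1.
    rewrite normcMn /K.
    have -> : 2 * (M + 1) * expR (M ^+ 2 + 1) * expR (- 1 * y) =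
        (M + 1) * expR y *+ 2 * (expR (M ^+ 2 + 1) * expR (- (2 * y))).
      have -> : expR (- 1 * y) = expR y * expR (- (2 * y)).
        by rewrite -expRD; congr expR; ring.
      by rewrite -mulr_natl; ring.
    by apply: ler_pM; rewrite ?normc_ge0 ?mulrn_wge0 ?normc_ge0 ?ler_wMn2r ?E ?bnd.
rewrite /int0y (_ : Num.sqrt pi / 2 = fine (Num.sqrt pi / 2)%:E)// -integral0y_gauss.
rewrite -integral_itv_obnd_cbnd; last first.
  apply/measurable_EFinP; apply: open_continuous_measurable_fun => // y _.
  exact: continuous_gauss_fun.
congr fine; apply: eq_integral => y _; congr EFin.
rewrite /gauss_fun vlineE expr2 /= !mul0r mulr0 addr0 cos0 mulr1 sub0r; congr expR; ring.
Qed.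

End Contour.

(** * Euler's integral with a complex parameter *)

Section ComplexGamma.
Local Open Scope complex_scope.
Local Open Scope ring_scope.
Context {R : realType}.
Implicit Types (f g df : R[i] -> R[i]) (a b c p q x y l s t u v : R) (z w : R[i]).
Import Normc.
Local Notation Re := complex.Re.
Local Notation Im := complex.Im.

Lemma ReZ x z : Re (x%:C * z) = x * Re z.
Proof. by case: z => a b /=; rewrite mul0r subr0. Qed.

Lemma ImZ x z : Im (x%:C * z) = x * Im z.
Proof. by case: z => a b /=; rewrite mul0r addr0. Qed.

Lemma ReN z : Re (- z) = - Re z. Proof. by case: z. Qed.
Lemma ReD z w : Re (z + w) = Re z + Re w. Proof. by case: z w => [? ?] [? ?]. Qed.
Lemma ImD z w : Im (z + w) = Im z + Im w. Proof. by case: z w => [? ?] [? ?]. Qed.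

Lemma powR_between (k N x q : R) : 0 < k -> k <= x <= N -> x `^ q <= k `^ q + N `^ q.
Proof.
move=> k0 /andP[kx xN]; have x0 : 0 < x by exact: lt_le_trans kx.
have N0 : 0 < N by exact: lt_le_trans xN.
have [q0|q0] := leP 0 q.
- have h : x `^ q <= N `^ q by apply: ge0_ler_powR; rewrite ?nnegrE// ltW.
  by rewrite (le_trans h)// lerDr powR_ge0.
- have h : x `^ q <= k `^ q.
    rewrite -(opprK q) !(powRN _ (- q)) lef_pV2 ?posrE ?powR_gt0//.
    by apply: ge0_ler_powR; rewrite ?nnegrE ?oppr_ge0// ltW.
  by rewrite (le_trans h)// lerDl powR_ge0.
Qed.

(** Deform the parameter along the segment k s = 1 + s (z - 1) from 1 to z. The
    integral of t ^ (p - 1) (k s) ^ p exp (- t k s) is constant in s, because its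
    derivative in s is the derivative in t of
    d (k s) ^ (p - 1) t ^ p exp (- t k s), which vanishes at both ends. The
    coefficient z0 turns the identity of real parts into a complex one. *)
Lemma complex_Gamma p z z0 : 0 < p -> 0 < Re z ->
  int0y (fun t => t `^ (p - 1) * Re (z0 * cexp (- (t%:C * z)))) =
  Gamma p * Re (z0 * cpow z (- p)).
Proof.
move=> p0 z0'; set r := Re z in z0'.
have [w0 w0E] : exists w, w = z0 * cpow z (- p) by eexists.
pose d := z - 1.
pose k s : R[i] := 1 + s%:C * d.
(* m bounds Re (k s) from below, and e is small enough for this to remain true
   on an open interval of parameters that contains both ends of the segment *)
pose m := Num.min 1 r / 2.
have m1 : m <= 1 / 2 by rewrite ler_pM2r// ge_min lexx.
have mr : m <= r / 2 by rewrite ler_pM2r// ge_min lexx orbT.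
have m0 : 0 < m by rewrite divr_gt0// lt_min ltr01.
pose e := m / (1 + `|r - 1|).
have a0 : 0 < 1 + `|r - 1| by rewrite ltr_pwDl.
have e0 : 0 < e by rewrite divr_gt0.
have er : e * `|r - 1| <= m.
  by rewrite /e mulrAC ler_pdivrMr// ler_pM2l// lerDr.
have Rek s : Re (k s) = 1 + s * (r - 1).
  by rewrite ReD ReZ /d ReD ReN.
have kRe s : - e < s < 1 + e -> m <= Re (k s).
  move=> /andP[s1 s2]; rewrite Rek.
  have h1 : - `|r - 1| <= r - 1 by rewrite lerNl -normrN ler_norm.
  have h2 : r - 1 <= `|r - 1| by rewrite ler_norm.
  set A := `|r - 1| in er h1 h2 a0.
  have [s0|s0] := leP 0 s; last nra.
  have [s3|s3] := leP s 1; last nra.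
  nra.
have kpos s : - e < s < 1 + e -> 0 < Re (k s) by move=> /kRe; exact: lt_le_trans.
pose N := 1 + (1 + e) * normc d.
have kN s : - e < s < 1 + e -> m <= normc (k s) <= N.
  move=> hs; apply/andP; split.
    exact: le_trans (kRe _ hs) (le_trans (ler_norm _) (ler_normc_Re _)).
  apply: (le_trans (le_normcD _ _)); rewrite /N normc1 lerD2l normcM normc_real.
  apply: ler_wpM2r; first exact: normc_ge0.
  by move: hs => /andP[h1 h2]; rewrite ler_norml; lra.
pose E s t : R[i] := cexp (- (t%:C * k s)).
have nE s t : - e < s < 1 + e -> 0 < t -> normc (E s t) <= expR (- m * t).
  move=> hs t0; rewrite normc_exp ler_expR ReN ReZ mulNr lerN2 mulrC.
  by rewrite ler_pM2l// kRe.
have cdk_s s : cderiv k s d by exact: cderiv_line.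
have cdid t : cderiv (fun t : R => t%:C) t 1.
  by apply: cderiv_real; exact: is_derive_id.
have cdE_s s t : cderiv (E ^~ t) s (- (t%:C * d) * E s t).
  have h := cderivM (cderiv_cst (- t%:C) s) (cdk_s s).
  have := cderiv_exp h; rewrite /E.
  under eq_fun do rewrite mulNr.
  by move=> /cderiv_eq; apply; rewrite mul0r add0r !mulNr.
have cdE_t s t : cderiv (E s) t (- k s * E s t).
  have h := cderivM (cdid t) (cderiv_cst (- k s) t).
  have := cderiv_exp h; rewrite /E.
  under eq_fun do rewrite mulrN.
  by move=> /cderiv_eq; apply; rewrite mulr0 addr0 mul1r mulrN.
pose P s t := Re ((t `^ (p - 1))%:C * (w0 * cpow (k s) p * E s t)).
pose G s t : R[i] := (t `^ (p - 1))%:C *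
  (w0 * d * (p%:C * cpow (k s) (p - 1) - t%:C * cpow (k s) p) * E s t).
pose T s t := Re ((t `^ p)%:C * (w0 * d * cpow (k s) (p - 1) * E s t)).
have dP s t : - e < s < 1 + e -> 0 < t -> is_derive s 1 (P ^~ t) (Re (G s t)).
  move=> hs t0.
  have h1 := cderivM (cderiv_cst w0 s) (cderiv_pow p (kpos s hs) (cdk_s s)).
  have h2 := cderivM (cderiv_cst (t `^ (p - 1))%:C s) (cderivM h1 (cdE_s s t)).
  have := (cderiv_eq h2 (w := G s t)) => H.
  by apply: (H _).1; rewrite /G; ring.
have dT s t : - e < s < 1 + e -> 0 < t -> is_derive t 1 (T s) (Re (G s t)).
  move=> hs t0.
  have h1 := cderivM (cderiv_cst (w0 * d * cpow (k s) (p - 1)) t) (cdE_t s t).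
  have h2 := cderivM (cderiv_real (is_derive_powR p t0)) h1.
  have := (cderiv_eq h2 (w := G s t)) => H.
  apply: (H _).1; rewrite /G.
  have -> : cpow (k s) p = k s * cpow (k s) (p - 1).
    by rewrite cpowD cpowN cpow1 ?kpos// mulrCA divff ?mulr1// -(cpow1 (kpos s hs)) cpow_neq0.
  rewrite rmorphM /= -(mulr_powRB1 (ltW t0) p0) rmorphM /=; ring.
pose B q := m `^ q + N `^ q.
have B0 q : 0 <= B q by rewrite addr_ge0 ?powR_ge0.
have nB q s : - e < s < 1 + e -> normc (cpow (k s) q) <= B q.
  by move=> hs; rewrite normc_pow ?kpos//; apply: powR_between => //; exact: kN.
pose K1 := normc (w0 * d) * p * B (p - 1).
pose K2 := normc (w0 * d) * B p.
have K10 : 0 <= K1 by rewrite !mulr_ge0 ?normc_ge0 ?(ltW p0).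
have K20 : 0 <= K2 by rewrite !mulr_ge0 ?normc_ge0.
have p10 : 0 < p + 1 by rewrite addr_gt0.
pose bound t := K1 * (t `^ (p - 1) * expR (- m * t)) + K2 * (t `^ (p + 1 - 1) * expR (- m * t)).
have ib : integrable0y bound.
  by apply: integrable0yD; apply: integrable0yZ; exact: integrable0y_Gamma.
have Gb s t : - e < s < 1 + e -> 0 < t -> normc (G s t) <= bound t.
  move=> hs t0.
  rewrite /G normcM normc_real ger0_norm ?powR_ge0// !normcM -(normcM w0 d).
  have hh : normc (p%:C * cpow (k s) (p - 1) - t%:C * cpow (k s) p) <= p * B (p - 1) + t * B p.
    apply: (le_trans (le_normcD _ _)); rewrite normcN !normcM !normc_real.
    by rewrite (gtr0_norm p0) (gtr0_norm t0); apply: lerD; rewrite ler_pM2l// nB.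
  apply: (@le_trans _ _ (t `^ (p - 1) *
    (normc (w0 * d) * (p * B (p - 1) + t * B p) * expR (- m * t)))).
    apply: ler_wpM2l; first exact: powR_ge0.
    apply: ler_pM; rewrite ?mulr_ge0 ?normc_ge0 ?nE//.
    by apply: ler_wpM2l; rewrite ?normc_ge0.
  rewrite /bound /K1 /K2 addrK -(mulr_powRB1 (ltW t0) p0).
  by rewrite [leLHS](_ : _ = normc (w0 * d) * p * B (p - 1) * (t `^ (p - 1) * expR (- m * t)) +
    normc (w0 * d) * B p * (t * t `^ (p - 1) * expR (- m * t)))//; ring.
have Tb s t : - e < s < 1 + e -> 0 < t ->
    `|T s t| <= normc (w0 * d) * B (p - 1) * (t `^ p * expR (- m * t)).
  move=> hs t0; apply: (le_trans (ler_normc_Re _)).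
  rewrite normcM normc_real ger0_norm ?powR_ge0// !normcM -(normcM w0 d) [leRHS]mulrCA.
  apply: ler_wpM2l; first exact: powR_ge0.
  apply: ler_pM; rewrite ?mulr_ge0 ?normc_ge0 ?nE//.
  by apply: ler_wpM2l; rewrite ?normc_ge0 ?nB.
have cP s : - e < s < 1 + e -> forall t, 0 < t -> {for t, continuous (P s)}.
  move=> hs t t0; apply: cdiff_continuous_Re; apply: cdiffM.
    by eexists; apply: cderiv_real; exact: is_derive_powR.
  by apply: cdiffM; [exact: cdiff_cst|eexists; exact: cdE_t].
have ->: (fun t => t `^ (p - 1) * Re (z0 * cexp (- (t%:C * z)))) = P 1.
  apply/funext => t; rewrite /P ReZ /E.
  have -> : k 1 = z by rewrite /k /d mul1r addrC subrK.
  by rewrite w0E -(mulrA z0) -cpowD addNr cpow0 mulr1.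
have F0 := cvg0_powR_expR p0 m0.
have TC (F : set_system R) : Filter F -> (\forall t \near F, 0 < t) -> forall s, - e < s < 1 + e ->
    (fun t => t `^ p * expR (- m * t)) @ F --> (0 : R) -> T s t @[t --> F] --> (0 : R).
  move=> FF Fpos s hs h0; apply: norm_cvg0.
  apply: (@squeeze_cvgr _ _ _ _ (fun=> 0)
     (fun t => normc (w0 * d) * B (p - 1) * (t `^ p * expR (- m * t)))).
  - near=> t; rewrite normr_ge0/= Tb//; near: t; exact: Fpos.
  - exact: cvg_cst.
  - suff : (fun t => normc (w0 * d) * B (p - 1) * (t `^ p * expR (- m * t))) @ F -->
       normc (w0 * d) * B (p - 1) * 0 by rewrite mulr0.
    by apply: cvgM => //; exact: cvg_cst.
have -> : int0y (P 1) = int0y (P 0).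
  apply: (@int0y_param_const _ P T (fun s t => Re (G s t)) (fun t => `|bound t|)
    (- e) (1 + e)) => //.
  - by apply/andP; split; lra.
  - by apply/andP; split; lra.
  - move=> s hs.
    apply: (integrable0y_le (cP s hs) (integrable0yZ (normc w0 * B p) (integrable0y_Gamma p0 m0))).
    move=> t t0; apply: (le_trans (ler_normc_Re _)).
    rewrite normcM normc_real ger0_norm ?powR_ge0// !normcM [leRHS]mulrCA.
    apply: ler_wpM2l; first exact: powR_ge0.
    apply: ler_pM; rewrite ?mulr_ge0 ?normc_ge0 ?nE//.
    by apply: ler_wpM2l; rewrite ?normc_ge0 ?nB.
  - move=> s t hs t0; apply: cdiff_continuous_Re; apply: cdiffM.
      by eexists; apply: cderiv_real; exact: is_derive_powR.
    apply: cdiffM; last by eexists; exact: cdE_t.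
    apply: cdiffM; first exact: cdiff_cst.
    rewrite (_ : (fun _ => _) = (fun t : R => p%:C * cpow (k s) (p - 1) + t%:C * (- cpow (k s) p))).
      apply: cdiffD; first exact: cdiff_cst.
      by apply: cdiffM; [eexists; exact: cdid|exact: cdiff_cst].
    by apply/funext => x; rewrite mulrN.
  - exact: (integrable_norm ib).
  - move=> s t hs t0; apply: (le_trans (ler_normc_Re _)).
    by apply: (le_trans (Gb s t hs t0)); exact: ler_norm.
  - move=> s hs; apply: TC => //; last exact: F0.1.
    exact: nbhs_right_gt.
  - move=> s hs; apply: TC => //; last exact: F0.2.
    by apply: nbhs_pinfty_gt; rewrite num_real.
rewrite GammaE mulrC -int0yZ; last exact: integrable0y_Gamma.
apply: eq_int0y => t t0.
rewrite /P /E; have -> : k 0 = 1 by rewrite /k mul0r addr0.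
have -> : cpow 1 p = 1 :> R[i].
  by rewrite -[1]/(1%:C) cpow_real// powR1.
have -> : cexp (- (t%:C * 1)) = (expR (- 1 * t))%:C.
  rewrite mulr1 /cexp ReN /= oppr0 cos0 sin0 mulr1 mulr0 mulN1r.
  by [].
rewrite mulr1 ReZ (mulrC w0) ReZ w0E; ring.
Unshelve. all: by end_near. Qed.

End ComplexGamma.

(** * Hankel's formula for the reciprocal Gamma function *)

Section Hankel.
Local Open Scope complex_scope.
Local Open Scope ring_scope.
Context {R : realType}.
Implicit Types (f g df : R[i] -> R[i]) (a b c p q x y l s t u v : R) (z w : R[i]).
Import Normc.
Local Notation Re := complex.Re.
Local Notation Im := complex.Im.

Lemma integrable0y_expRN : integrable0y (fun y : R => expR (- 1 * y)).
Proof.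
apply: eq_integrable0y (integrable0y_Gamma (@ltr01 R) (@ltr01 R)).
by move=> t t0; rewrite subrr powRr0 mul1r.
Qed.

Lemma cdiff_vline c y : cdiff (vline c) y.
Proof. by exists 'i%C; exact: cderiv_vline_y. Qed.

Lemma cdiff_gauss_vline c y : cdiff (fun t => cexp (vline c t ^+ 2)) y.
Proof. by apply/cdiff_exp/cdiffX; exact: cdiff_vline. Qed.

Lemma cdiff_pow_vline c y q : 0 < c -> cdiff (fun t => cpow (vline c t) q) y.
Proof. by move=> c0; apply: cdiff_pow; [rewrite Re_vline|exact: cdiff_vline]. Qed.

Lemma normc_gauss_vline c y : normc (cexp (vline c y ^+ 2)) = expR (c ^+ 2 - y ^+ 2).
Proof. by rewrite normc_exp Re_vline_sqr. Qed.

Lemma normc_pow_vline c y q : 0 < c -> normc (cpow (vline c y) q) = normc (vline c y) `^ q.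
Proof. by move=> c0; rewrite normc_pow// Re_vline. Qed.

(** Hankel's contour integral for the reciprocal Gamma function at (1 - q) / 2,
    parametrized by w = z ^ 2 on the line Re z = c and folded onto y > 0. *)
Definition hankel c q := 2 / pi *
  int0y (fun y => Re (cexp (vline c y ^+ 2) * cpow (vline c y) q)).

Lemma hankel_bound c q : 1 <= c -> exists2 K, 0 < K & forall y,
  normc (cexp (vline c y ^+ 2) * cpow (vline c y) q) <= K * expR (- 1 * y).
Proof.
move=> c1; have [K K0 hK] := @gauss_pow_bound R c q.
have c0 : 0 < c by exact: lt_le_trans c1.
exists K => // y; rewrite normcM normc_gauss_vline normc_pow_vline//.
by apply: hK; rewrite // c1 lexx.
Qed.

Lemma cdiff_hankel c q y : 0 < c ->
  cdiff (fun y => cexp (vline c y ^+ 2) * cpow (vline c y) q) y.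
Proof.
by move=> c0; apply: cdiffM; [exact: cdiff_gauss_vline|exact: cdiff_pow_vline].
Qed.

Lemma integrable0y_hankel c q : 1 <= c ->
  integrable0y (fun y => Re (cexp (vline c y ^+ 2) * cpow (vline c y) q)).
Proof.
move=> c1; have [K K0 hK] := hankel_bound q c1.
have c0 : 0 < c by exact: lt_le_trans c1.
apply: (integrable0y_le _ (integrable0yZ K integrable0y_expRN)).
  by move=> y y0; apply: cdiff_continuous_Re; exact: cdiff_hankel.
by move=> y _; apply: (le_trans (ler_normc_Re _)).
Qed.

(** Integration by parts of Im (exp (z ^ 2) z ^ (- 2 b)) / 2 along the line. *)
Lemma hankel_rec c b : 1 <= c -> hankel c (1 - 2 * b) = b * hankel c (1 - 2 * (b + 1)).
Proof.
move=> c1; have c0 : 0 < c by exact: lt_le_trans c1.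
rewrite /hankel [RHS]mulrCA; congr (_ * _).
have i1 := integrable0y_hankel (1 - 2 * b) c1.
have i2 := integrable0y_hankel (1 - 2 * (b + 1)) c1.
rewrite -int0yZ//.
pose f1 y := Re (cexp (vline c y ^+ 2) * cpow (vline c y) (1 - 2 * b)).
pose f2 y := Re (cexp (vline c y ^+ 2) * cpow (vline c y) (1 - 2 * (b + 1))).
have i3 : integrable0y (fun y => f1 y + - b * f2 y).
  by apply: integrable0yD => //; exact: integrable0yZ.
pose F y := Im (2^-1%:C * (cexp (vline c y ^+ 2) * cpow (vline c y) (- (2 * b)))).
have dF y : is_derive y 1 F (f1 y + - b * f2 y).
  have cy := cderiv_vline_y c y.
  have cy2 := cderiv_exp (cderivM cy cy).
  have Rc : 0 < Re (vline c y) by rewrite Re_vline.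
  have cy3 := cderivM cy2 (cderiv_pow (- (2 * b)) Rc cy).
  have cy4 := cderivM (cderiv_cst 2^-1%:C y) cy3.
  have := cy4.2; rewrite /F.
  under eq_fun do rewrite -expr2.
  move=> /is_derive_eq; apply.
  rewrite mul0r add0r.
  set e := cexp _.
  have -> : f1 y + - b * f2 y = Re (e * cpow (vline c y) (1 - 2 * b) +
      (- b)%:C * (e * cpow (vline c y) (1 - 2 * (b + 1)))).
    by rewrite ReD ReZ /f1 /f2 /e expr2.
  rewrite -ImiRe; congr (Im _).
  have -> : cpow (vline c y) (1 - 2 * b) = vline c y * cpow (vline c y) (- (2 * b)).
    by rewrite cpowD cpow1// Re_vline.
  have -> : 1 - 2 * (b + 1) = - (2 * b) - 1 by ring.
  have h2 : 2^-1%:C * (2 : R)%:C = 1 :> R[i] by rewrite -rmorphM /= mulVf.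
  rewrite !rmorphN !rmorphM /=.
  set w := vline c y; set A := cpow w _; set B := cpow w _.
  have -> : 2^-1%:C * (('i%C * w + w * 'i%C) * e * A + e * (- (2%:C * b%:C) * B * 'i%C)) =
    2^-1%:C * 2 * (w * e * A * 'i%C) - (2^-1%:C * 2%:C) * (e * b%:C * B * 'i%C) by ring.
  have -> : 2 = (2 : R)%:C :> R[i] by rewrite rmorph_nat.
  rewrite h2. ring.
have : int0y (fun y => f1 y + - b * f2 y) = 0 - 0.
  apply: (@int0y_deriv _ F) => //.
  - move=> y _; apply: cvgD.
      by apply: cdiff_continuous_Re; exact: cdiff_hankel.
    apply: cvgM; first exact: cvg_cst.
    by apply: cdiff_continuous_Re; exact: cdiff_hankel.
  - apply: cvg_at_right_filter.
    suff : F y @[y --> (0 : R)] --> F 0.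
      have -> // : F 0 = 0.
      rewrite /F ImZ -/(vline c 0) (_ : vline c 0 = c%:C); last by rewrite /vline mul0r addr0.
      rewrite cpow_real// /cexp /= !mulr0 !mul0r !addr0 sin0 mulr0.
      by rewrite mul0r addr0 mulr0.
    exact: is_derive_continuous (dF 0).
  - have [K K0 hK] := hankel_bound (- (2 * b)) c1.
    apply: (@cvg0_expR_bound _ _ K 1) => // y _.
    rewrite /F ImZ normrM ger0_norm ?invr_ge0//.
    apply: (@le_trans _ _ (1 * `|Im (cexp (vline c y ^+ 2) * cpow (vline c y) (- (2 * b)))|)).
      by apply: ler_wpM2r => //; lra.
    by rewrite mul1r; apply: (le_trans (ler_normc_Im _)).
rewrite subrr int0yD//; last exact: integrable0yZ.
have -> : int0y (fun y => - b * f2 y) = - b * int0y f2 by exact: int0yZ.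
have -> : int0y (fun y => b * f2 y) = b * int0y f2 by exact: int0yZ.
by move=> /eqP; rewrite addr_eq0 => /eqP ->; rewrite mulNr opprK.
Qed.

(** Multiply by Gamma (2 b - 1), insert Euler's integral for the power of z and
    exchange the integrals: exp (z ^ 2 - t z) is
    exp (- t ^ 2 / 4) exp ((z - t / 2) ^ 2), a Gaussian on a shifted line, so that
    only a Gaussian moment is left. *)
Lemma hankel_Gamma_gt1 c b : 1 <= c -> 1 < b -> hankel c (1 - 2 * b) = (Gamma b)^-1.
Proof.
move=> c1 b1; have c0 : 0 < c by exact: lt_le_trans c1.
have b0 : 0 < b by exact: lt_trans b1.
set p := 2 * b - 1.
have p1 : 1 < p by rewrite /p; lra.
have p0 : 0 < p by exact: lt_trans p1.
have -> : 1 - 2 * b = - p by rewrite /p; ring.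
pose I := int0y (fun y => Re (cexp (vline c y ^+ 2) * cpow (vline c y) (- p))).
have iI := integrable0y_hankel (- p) c1.
pose K y t := t `^ (p - 1) * (expR (c ^+ 2 - y ^+ 2 - t * c) * cos (2 * c * y - t * y)).
have KE y t : K y t = t `^ (p - 1) * Re (cexp (vline c y ^+ 2) * cexp (- (t%:C * vline c y))).
  rewrite /K -cexpD; congr (_ * _).
  rewrite vlineE expr2 /cexp /=; congr (expR _ * cos _); ring.
have KE2 y t : K y t = gauss_moment p t * Re (cexp (vline (c - t / 2) y ^+ 2)).
  rewrite /K /gauss_moment -[RHS]mulrA; congr (_ * _).
  rewrite vlineE expr2 /cexp /= mulrA -expRD; congr (expR _ * cos _); by field.
have e1 : Gamma p * I = int0y (fun y => int0y (K y)).
  rewrite /I -int0yZ//; apply: eq_int0y => y y0.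
  rewrite -complex_Gamma ?Re_vline//; apply: eq_int0y => t t0.
  by rewrite KE.
have e2 : int0y (fun t => int0y (K ^~ t)) = Num.sqrt pi / 2 * int0y (gauss_moment p).
  rewrite -int0yZ; last exact: integrable0y_gauss_moment.
  apply: eq_int0y => t t0; rewrite mulrC -(int0y_gauss_line (c - t / 2)) -int0yZ.
    by apply: eq_int0y => y y0; rewrite KE2.
  pose k := expR ((c - t / 2) ^+ 2) * expR 1.
  apply: (integrable0y_le _ (integrable0yZ k integrable0y_expRN)).
    by move=> y _; apply: cdiff_continuous_Re; exact: cdiff_gauss_vline.
  move=> y y0; apply: (le_trans (ler_normc_Re _)).
  rewrite normc_gauss_vline /k -!expRD ler_expR; have := sqr_ge0 (y - 1).
  by rewrite sqrrB; lra.
have e3 : int0y (fun y => int0y (K y)) = int0y (fun t => int0y (K ^~ t)).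
  apply: (@fubini0y _ K (fun y => expR (c ^+ 2 - y ^+ 2))
      (fun t => t `^ (p - 1) * expR (- c * t))).
  - apply: measurable_funM.
      exact: (measurableT_comp (measurable_powR (p - 1)) measurable_snd).
    apply: measurable_funM.
      apply: measurableT_comp => //; apply: measurable_funB.
        by apply: measurable_funB => //; apply: measurable_funX.
      exact: measurable_funM.
    apply: measurableT_comp; first by apply: continuous_measurable_fun; exact: continuous_cos.
    apply: measurable_funB; last exact: measurable_funM.
    by apply: measurable_funM.
  - apply: (integrable0y_le _ (integrable0yZ (expR (c ^+ 2) * expR 1) integrable0y_expRN)).
      move=> y _; apply: (@cvg_comp _ _ _ (fun y => c ^+ 2 - y ^+ 2) expR);
        last exact: continuous_expR.
      by apply: cvgB; [exact: cvg_cst|exact: exprn_continuous].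
    move=> y y0; rewrite ger0_norm ?expR_ge0// -!expRD ler_expR.
    by have := sqr_ge0 (y - 1); rewrite sqrrB; lra.
  - exact: integrable0y_Gamma.
  - move=> y t y0 t0; rewrite /K normrM ger0_norm ?powR_ge0// mulrCA.
    apply: ler_wpM2l; first exact: powR_ge0.
    rewrite normrM ger0_norm ?expR_ge0// -expRD.
    apply: (@le_trans _ _ (expR (c ^+ 2 - y ^+ 2 - t * c) * 1)).
      by apply: ler_wpM2l; [exact: expR_ge0|exact: cos_max].
    by rewrite mulr1 ler_expR; lra.
have e4 := Gamma_gauss_moment b1.
rewrite -/p in e4.
have Gp := Gamma_gt0 p0. have Gb := Gamma_gt0 b0.
have pn0 : pi != 0 :> R by rewrite gt_eqF// pi_gt0.
have sp : Num.sqrt pi ^+ 2 = pi :> R by rewrite sqr_sqrtr// pi_ge0.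
apply: (mulfI (lt0r_neq0 Gp)); apply: (mulfI (lt0r_neq0 Gb)).
rewrite /hankel -/I.
have -> : Gamma b * (Gamma p * (2 / pi * I)) = 2 / pi * (Gamma b * (Gamma p * I)) by ring.
rewrite e1 e3 e2.
have aux (P S G X Y : R) : P != 0 -> G != 0 -> S ^+ 2 = P -> G * X = S * Y ->
    2 / P * (G * (S / 2 * X)) = G * (Y * G^-1).
  move=> P0 G0 SP GX.
  have -> : 2 / P * (G * (S / 2 * X)) = S / P * (G * X) by field.
  rewrite GX -SP; field; rewrite G0 /=; move: P0; rewrite -SP.
  by apply: contra => /eqP ->; rewrite expr0n.
by apply: aux => //; rewrite gt_eqF.
Qed.

Lemma hankel_Gamma c x : 1 <= c -> 0 < x -> hankel c (1 - 2 * x) = (Gamma x)^-1.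
Proof.
move=> c1 x0; rewrite hankel_rec// hankel_Gamma_gt1 ?ltrDr// GammaD1//.
by have := Gamma_gt0 x0 => h; field; rewrite !gt_eqF.
Qed.

Lemma hankel_rgamma c x : 1 <= c -> hankel c (1 - 2 * x) = rgamma x.
Proof.
move=> c1; rewrite /rgamma; set n := (Num.truncn `|x|).+1.
have xn : 0 < x + n%:R.
  have h := truncnS_gt `|x|; have : - x <= `|x| by rewrite -normrN ler_norm.
  by rewrite -/n in h; lra.
rewrite -(hankel_Gamma c1 xn).
elim: (n) => [|k ih]; first by rewrite big_geq// mul1r addr0.
rewrite ih hankel_rec// big_nat_recr//= -mulrA; congr (_ * (_ * hankel _ _)).
by rewrite -natr1; ring.
Qed.

End Hankel.

(** * The contour integral of the Mittag-Leffler function *)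

Section MittagLeffler.
Local Open Scope complex_scope.
Local Open Scope ring_scope.
Context {R : realType}.
Implicit Types (f g df : R[i] -> R[i]) (al a b c p q x y l s t u v : R) (z w : R[i]).
Import Normc.
Local Notation Re := complex.Re.
Local Notation Im := complex.Im.

Definition ml_den al x z : R[i] := cpow z (2 * al) + x%:C.

(** In the right half-plane the argument of z ^ (2 al) is at most pi al1 < pi in
    absolute value, so z ^ (2 al) stays in a fixed sector away from the negative
    half-line. *)
Lemma ml_den_lower al1 : 0 < al1 < 1 -> exists2 d, 0 < d &
  forall al x z, 0 < al <= al1 -> 0 <= x -> 0 < Re z ->
    d * x <= normc (ml_den al x z) /\ d * normc z `^ (2 * al) <= normc (ml_den al x z).
Proof.
move=> /andP[al10 al11].
set C := cos (pi * al1).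
have pi0 : (0 : R) < pi := pi_gt0 R.
have C1 : -1 < C.
  rewrite -cospi /C ltr_cos ?in_itv/= ?mulr_ge0 ?pi_ge0 ?lexx ?(ltW al10)//=.
    by rewrite gtr_pMr.
  by rewrite ler_piMr ?pi_ge0 ?ltW.
have C2 : C <= 1 by exact: cos_le1.
pose D := (1 + C) / 2.
have D0 : 0 < D by rewrite divr_gt0//; lra.
exists (Num.sqrt D); first by rewrite sqrtr_gt0.
move=> al x z /andP[al0 ala] x0 z0.
set ph := 2 * al * Im (clog z).
have phle : `|ph| <= pi * al1.
  rewrite /ph /clog /= !normrM (ger0_norm (ltW al0)) ger0_norm//.
  have : `|atan (Im z / Re z)| <= pi / 2.
    by rewrite ler_norml !ltW ?atan_ltpi2 ?atan_gtNpi2.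
  set A := `|atan _|; have : 0 <= A by exact: normr_ge0.
  by clearbody A; nra.
have cosph : C <= cos ph.
  rewrite -cos_norm /C leNgt ltr_cos ?in_itv/= ?normr_ge0 ?mulr_ge0 ?(ltW al10) ?pi_ge0//=.
  - by rewrite -leNgt.
  - by rewrite ler_piMr ?pi_ge0 ?ltW.
  - by rewrite (le_trans phle)// ler_piMr ?pi_ge0 ?ltW.
set r := normc z `^ (2 * al).
have r0 : 0 <= r by exact: powR_ge0.
have rE : expR (Re ((2 * al)%:C * clog z)) = r.
  by rewrite -normc_exp -/(cpow _ _) normc_pow.
have nE : normc (ml_den al x z) ^+ 2 = r ^+ 2 + 2 * r * x * cos ph + x ^+ 2.
  rewrite normc_sqr /ml_den ReD ImD /cpow /cexp rE.
  rewrite [Im (_ * clog z)]ImZ -/ph /= addr0.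
  have -> : r ^+ 2 + 2 * r * x * cos ph + x ^+ 2 =
      r ^+ 2 * (cos ph ^+ 2 + sin ph ^+ 2) + 2 * r * x * cos ph + x ^+ 2.
    by rewrite cos2Dsin2 mulr1.
  ring.
have key : D * (r ^+ 2 + x ^+ 2) <= normc (ml_den al x z) ^+ 2.
  rewrite nE /D.
  have rx : 0 <= r * x by exact: mulr_ge0.
  have h : r * x * C <= r * x * cos ph by exact: ler_wpM2l.
  have h2 := sqr_ge0 (r - x); have h3 := sqr_ge0 (r + x).
  rewrite sqrrB in h2; rewrite sqrrD in h3.
  clearbody C r ph; nra.
have sq a : 0 <= a -> D * a ^+ 2 <= normc (ml_den al x z) ^+ 2 ->
    Num.sqrt D * a <= normc (ml_den al x z).
  move=> a0 h; rewrite -(@ler_pXn2r _ 2) ?nnegrE ?normc_ge0 ?mulr_ge0 ?sqrtr_ge0//.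
  by rewrite exprMn sqr_sqrtr// ltW.
split; apply: sq => //; apply: le_trans key; rewrite ler_pM2l//.
  by rewrite lerDr sqr_ge0.
by rewrite lerDl sqr_ge0.
Qed.

(** For q = 2 al - 1 this is the Mittag-Leffler function at - x; the other
    exponents occur as remainders. *)
Definition ml_integral al x c q := 2 / pi *
  int0y (fun y => Re (cexp (vline c y ^+ 2) * (cpow (vline c y) q * (ml_den al x (vline c y))^-1))).

Lemma ml_den_neq0 al x z : 0 < al < 1 -> 0 <= x -> 0 < Re z -> ml_den al x z != 0.
Proof.
move=> /andP[al0 al1] x0 z0.
have [|d d0 hd] := @ml_den_lower al; first by rewrite al0.
have [|||_ h] := hd al x z; rewrite ?al0 ?lexx//.
apply/eqP => e; move: h; rewrite e normc0 leNgt mulr_gt0//.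
by apply: powR_gt0; exact: normc_gt0.
Qed.

Lemma normc_ml_le d al x z q : 0 < d -> 0 < Re z ->
  d * normc z `^ (2 * al) <= normc (ml_den al x z) ->
  normc (cpow z q * (ml_den al x z)^-1) <= d^-1 * normc z `^ (q - 2 * al).
Proof.
move=> d0 z0 h; have n0 := normc_gt0 z0.
have p0 : 0 < normc z `^ (2 * al) by exact: powR_gt0.
rewrite normcM normcV normc_pow// powRB; last by apply/implyP => _; rewrite gt_eqF.
rewrite mulrCA; apply: ler_wpM2l; first exact: powR_ge0.
by rewrite -invfM lef_pV2 ?posrE ?mulr_gt0// (lt_le_trans _ h)// mulr_gt0.
Qed.

Lemma cdiff_ml al x c q y : 0 < al < 1 -> 0 <= x -> 0 < c ->
  cdiff (fun y => cexp (vline c y ^+ 2) * (cpow (vline c y) q * (ml_den al x (vline c y))^-1)) y.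
Proof.
move=> hal x0 c0; apply: cdiffM; first exact: cdiff_gauss_vline.
apply: cdiffM; first exact: cdiff_pow_vline.
apply: cdiffV; first by apply: ml_den_neq0; rewrite ?Re_vline.
by apply: cdiffD; [exact: cdiff_pow_vline|exact: cdiff_cst].
Qed.

Lemma integrable0y_ml al x c q : 0 < al < 1 -> 0 <= x -> 1 <= c ->
  integrable0y (fun y => Re (cexp (vline c y ^+ 2) *
    (cpow (vline c y) q * (ml_den al x (vline c y))^-1))).
Proof.
move=> hal x0 c1; have c0 : 0 < c by exact: lt_le_trans c1.
have [al0 al1] := andP hal.
have [d d0 hd] := ml_den_lower hal.
have [K K0 hK] := @gauss_pow_bound R c (q - 2 * al).
apply: (integrable0y_le _ (integrable0yZ (d^-1 * K) integrable0y_expRN)).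
  by move=> y _; apply: cdiff_continuous_Re; exact: cdiff_ml.
move=> y _; apply: (le_trans (ler_normc_Re _)); rewrite normcM normc_gauss_vline.
have Rc : 0 < Re (vline c y) by rewrite Re_vline.
have [|||_ h] := hd al x (vline c y); rewrite ?al0 ?lexx//.
apply: (le_trans (ler_wpM2l (expR_ge0 _) (normc_ml_le q d0 Rc h))).
rewrite mulrCA -mulrA; apply: ler_wpM2l; first by rewrite invr_ge0 ltW.
by apply: hK; rewrite ?c1 ?lexx.
Qed.

(** Solved for the term with the factor x, it produces the expansion in powers of
    1 / x; solved for the other term, the one in powers of x. *)
Lemma ml_step al x c q : 0 < al < 1 -> 0 <= x -> 1 <= c ->
  ml_integral al x c (q + 2 * al) + x * ml_integral al x c q = hankel c q.
Proof.
move=> hal x0 c1; have c0 : 0 < c by exact: lt_le_trans c1.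
rewrite /ml_integral /hankel mulrCA -mulrDr; congr (_ * _).
have i1 := integrable0y_ml (q + 2 * al) hal x0 c1.
have i2 := integrable0y_ml q hal x0 c1.
rewrite -int0yZ// -int0yD//; last exact: integrable0yZ.
apply: eq_int0y => y y0; rewrite -ReZ -ReD; congr (Re _).
have Rc : 0 < Re (vline c y) by rewrite Re_vline.
have := ml_den_neq0 hal x0 Rc; rewrite /ml_den cpowD => h.
by field.
Qed.

Lemma ml_shift al x c c' q : 0 < al < 1 -> 0 <= x -> 1 < c -> 1 < c' ->
  ml_integral al x c q = ml_integral al x c' q.
Proof.
move=> hal x0 c1 c1'; rewrite /ml_integral; congr (_ * _).
have [al0 al1] := andP hal.
(* the open strip 1 < Re z < M contains both lines *)
pose M := Num.max c c' + 1.
have cM : c < M by rewrite /M ltr_pwDr// le_max lexx.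
have cM' : c' < M by rewrite /M ltr_pwDr// le_max lexx orbT.
have [d d0 hd] := ml_den_lower hal.
have [K K0 hK] := @gauss_pow_bound R M (q + 1 - 2 * al).
pose f z := cexp (z ^+ 2) * (cpow z q * (ml_den al x z)^-1).
pose df1 z := (z + z) * cexp (z ^+ 2) * (cpow z q * (ml_den al x z)^-1).
pose df2 z := cexp (z ^+ 2) * (q%:C * cpow z (q - 1) * (ml_den al x z)^-1).
pose df3 z := cexp (z ^+ 2) *
  (cpow z q * (- ((2 * al)%:C * cpow z (2 * al - 1)) / ml_den al x z ^+ 2)).
pose df z := df1 z + (df2 z + df3 z).
pose K' := d^-1 * K * (3 + `|q| + 2 * al / d).
have hol z : 1 < Re z < M -> holo f df z.
  move=> /andP[z1 _]; have z0 : 0 < Re z by exact: lt_trans z1.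
  have dn := ml_den_neq0 hal x0 z0.
  have hexp : holo (fun z => cexp (z * z)) (fun z => (1 * z + z * 1) * cexp (z * z)) z.
    by apply: holo_exp; apply: holoM; exact: holo_id.
  have hden : holo (fun z => ml_den al x z) (fun z => (2 * al)%:C * cpow z (2 * al - 1) + 0) z.
    by apply: holoD; [exact: holo_pow|exact: holo_cst].
  have h := holoM hexp (holoM (holo_pow q z0) (holoV dn hden)).
  move=> k t w kz kw; have := h k t w kz kw; rewrite /f.
  under eq_fun do rewrite -expr2.
  move=> /cderiv_eq; apply; congr (_ * _).
  by rewrite /df /df1 /df2 /df3 addr0 !mul1r mulr1 !expr2; ring.
have cdf s y : 1 < s < M -> 0 < y -> cdiff (fun t => df (vline s t)) y.
  move=> /andP[s1 _] y0; have s0 : 0 < s by exact: lt_trans s1.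
  have dn : ml_den al x (vline s y) != 0 by apply: ml_den_neq0; rewrite ?Re_vline.
  have cden : cdiff (fun t => ml_den al x (vline s t)) y.
    by apply: cdiffD; [exact: cdiff_pow_vline|exact: cdiff_cst].
  have cg := cdiff_gauss_vline s y.
  have cp r := cdiff_pow_vline y r s0.
  have cV := cdiffV dn cden.
  have dn2 : ml_den al x (vline s y) ^+ 2 != 0 by rewrite expf_neq0.
  have cV2 := cdiffV dn2 (cdiffX 2 cden).
  apply: cdiffD; last apply: cdiffD.
  - apply: cdiffM; last by apply: cdiffM.
    by apply: cdiffM => //; apply: cdiffD; exact: cdiff_vline.
  - apply: cdiffM => //; apply: cdiffM => //.
    by apply: cdiffM => //; exact: cdiff_cst.
  - apply: cdiffM => //; apply: cdiffM => //.
    apply: cdiffM => //.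
    rewrite (_ : (fun _ => _) = (fun t => (- (2 * al)%:C) * cpow (vline s t) (2 * al - 1))).
      by apply: cdiffM => //; exact: cdiff_cst.
    by apply/funext => t; rewrite mulNr.
have K'1 : d^-1 * K <= K'.
  rewrite /K' ler_peMr ?mulr_ge0 ?invr_ge0 ?(ltW d0) ?(ltW K0)//.
  have : 0 <= 2 * al / d by rewrite divr_ge0 ?mulr_ge0 ?ltW.
  by have := normr_ge0 q; lra.
have K'0 : 0 <= K'.
  by apply: le_trans K'1; rewrite mulr_ge0 ?invr_ge0 ?ltW.
have bnd s y r (hs : 1 < s < M) : r <= q + 1 - 2 * al ->
    expR (s ^+ 2 - y ^+ 2) * normc (vline s y) `^ r <= K * expR (- 1 * y).
  by move=> hr; apply: hK => //; case/andP: hs => h1 h2; rewrite !ltW.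
have low s y : 1 < s < M -> d * normc (vline s y) `^ (2 * al) <= normc (ml_den al x (vline s y)).
  move=> /andP[s1 _]; have s0 : 0 < Re (vline s y) by rewrite Re_vline; exact: lt_trans s1.
  by have [|||_ h] := hd al x (vline s y); rewrite ?al0 ?lexx.
have main r s y : 1 < s < M -> r <= q + 1 ->
    expR (s ^+ 2 - y ^+ 2) * normc (cpow (vline s y) r * (ml_den al x (vline s y))^-1) <=
    d^-1 * (K * expR (- 1 * y)).
  move=> hs hr; have s0 : 0 < Re (vline s y).
    by rewrite Re_vline; case/andP: hs => h1 _; exact: lt_trans h1.
  apply: (le_trans (ler_wpM2l (expR_ge0 _) (normc_ml_le r d0 s0 (low s y hs)))).
  rewrite mulrCA; apply: ler_wpM2l; first by rewrite invr_ge0 ltW.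
  by apply: bnd => //; lra.
apply: (@contour_shift _ f df 1 M c c' K') => //.
- by rewrite c1 cM.
- by rewrite c1' cM'.
- move=> s /andP[s1 _]; have s0 : 0 < s by exact: lt_trans s1.
  have -> : vline s 0 = s%:C by rewrite /vline mul0r addr0.
  rewrite /f /ml_den !cpow_real// -rmorphD -rmorphXn /= /cexp /= sin0 cos0.
  by rewrite !mulr0 !mul0r !oppr0 !mulr0 !addr0 ?mulr0.
- move=> s y hs y0; rewrite /f normcM normc_gauss_vline.
  apply: (le_trans (main q s y hs _)); first by rewrite lerDl.
  by rewrite mulrA; apply: ler_wpM2r; rewrite ?expR_ge0.
- move=> s y hs y0.
  have s0 : 0 < Re (vline s y).
    by rewrite Re_vline; case/andP: hs => h1 _; exact: lt_trans h1.
  have n0 : 0 < normc (vline s y) by exact: normc_gt0.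
  pose W r := cexp (vline s y ^+ 2) * (cpow (vline s y) r * (ml_den al x (vline s y))^-1).
  have nW r : r <= q + 1 -> normc (W r) <= d^-1 * (K * expR (- 1 * y)).
    by move=> hr; rewrite normcM normc_gauss_vline; exact: main.
  set B := d^-1 * (K * expR (- 1 * y)) in main nW *.
  have B0 : 0 <= B.
    by rewrite !mulr_ge0 ?invr_ge0 ?expR_ge0 ?ltW.
  have b1 : normc (df1 (vline s y)) <= 2 * B.
    rewrite [df1 _](_ : _ = W (q + 1) *+ 2).
      by rewrite normcMn -[leLHS]mulr_natl ler_pM2l// nW.
    by rewrite /df1 /W cpowD cpow1// mulr2n; ring.
  have b2 : normc (df2 (vline s y)) <= `|q| * B.
    rewrite [df2 _](_ : _ = q%:C * W (q - 1)); last by rewrite /df2 /W; ring.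
    by rewrite normcM normc_real ler_wpM2l// nW//; lra.
  have b3 : normc (df3 (vline s y)) <= 2 * al / d * B.
    rewrite [df3 _](_ : _ = - (2 * al)%:C *
        (W (q - 1) * (cpow (vline s y) (2 * al) / ml_den al x (vline s y)))); last first.
      rewrite /df3 /W !cpowD !cpowN cpow1//.
      have := ml_den_neq0 hal x0 s0.
      have : vline s y != 0.
        by apply: contraTneq n0 => ->; rewrite normc0 ltxx.
      set D := ml_den _ _ _; set P := cpow _ (2 * al); set Q := cpow _ q.
      set E := cexp _; set Z := vline s y; set A := (2 * al)%:C.
      by clearbody D P Q E Z A => h1 h2; field; rewrite h1 h2.
    rewrite normcM normcN normc_real ger0_norm ?mulr_ge0 ?(ltW al0)//.
    rewrite -[leRHS]mulrA ler_pM2l ?mulr_gt0// normcM [leLHS]mulrC.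
    apply: ler_pM; rewrite ?normc_ge0//; last by apply: nW; lra.
    apply: (le_trans (normc_ml_le (2 * al) d0 s0 (low s y hs))).
    by rewrite subrr powRr0 mulr1.
  rewrite /df; apply: (le_trans (le_normcD _ _)).
  apply: (le_trans (lerD b1 (le_trans (le_normcD _ _) (lerD b2 b3)))).
  rewrite /K' -/B -mulrDl -mulrDl.
  rewrite (_ : _ * _ * _ * expR _ = (3 + `|q| + 2 * al / d) * B); last by rewrite /B; ring.
  by apply: ler_wpM2r => //; lra.
Qed.

End MittagLeffler.

(** * Expansion of the Mittag-Leffler function at infinity *)

Section Expansion.
Local Open Scope complex_scope.
Local Open Scope ring_scope.
Context {R : realType}.
Implicit Types (al a b c p q x y l s t u v : R) (z w : R[i]).
Import Normc.
Local Notation Re := complex.Re.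
Local Notation Im := complex.Im.

(** The total mass of the dominating function exp (- y), with the normalization
    of [ml_integral]. *)
Definition ml_const : R := 2 / pi * int0y (fun y : R => expR (- 1 * y)).

Lemma ml_const_ge0 : 0 <= ml_const.
Proof.
rewrite /ml_const mulr_ge0 ?divr_ge0 ?pi_ge0//.
by apply: Rintegral_ge0 => y _; exact: expR_ge0.
Qed.

Lemma ml_integral_bound al x c q B : 0 < al < 1 -> 0 <= x -> 0 < c ->
  (forall y, normc (cexp (vline c y ^+ 2) * (cpow (vline c y) q * (ml_den al x (vline c y))^-1))
     <= B * expR (- 1 * y)) ->
  `|ml_integral al x c q| <= ml_const * B.
Proof.
move=> hal x0 c0 hB; rewrite /ml_integral /ml_const normrM ger0_norm; last first.
  by rewrite divr_ge0 ?pi_ge0.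
rewrite -[leRHS]mulrA; apply: ler_wpM2l; first by rewrite divr_ge0 ?pi_ge0.
rewrite [leRHS]mulrC -int0yZ; last exact: integrable0y_expRN.
apply: ler_norm_int0y.
- by move=> y _; apply: cdiff_continuous_Re; exact: cdiff_ml.
- by apply: integrable0yZ; exact: integrable0y_expRN.
- by move=> y _; exact: le_trans (ler_normc_Re _) (hB y).
Qed.

Lemma ml_integral_expand_x al x c n : 0 < al < 1 -> 0 <= x -> 1 <= c ->
  ml_integral al x c (2 * al - 1) =
  \sum_(0 <= i < n) (- x) ^+ i * (Gamma (al * i%:R + 1))^-1 +
  (- x) ^+ n * ml_integral al x c (2 * al - 1 - 2 * al * n%:R).
Proof.
move=> hal x0 c1; have [al0 al1] := andP hal.
elim: n => [|n ih]; first by rewrite big_geq// add0r expr0 mul1r mulr0 subr0.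
rewrite ih big_nat_recr//= -[RHS]addrA; congr (_ + _).
have := ml_step (- 1 - 2 * al * n%:R) hal x0 c1.
have -> : - 1 - 2 * al * n%:R + 2 * al = 2 * al - 1 - 2 * al * n%:R by ring.
have -> : hankel c (- 1 - 2 * al * n%:R) = (Gamma (al * n%:R + 1))^-1.
  rewrite -(hankel_Gamma c1); last by apply: ltr_wpDl => //; rewrite mulr_ge0// ltW.
  by congr hankel; ring.
have -> : 2 * al - 1 - 2 * al * n.+1%:R = - 1 - 2 * al * n%:R by rewrite -natr1; ring.
by move=> <-; rewrite exprS; ring.
Qed.

(** On the line Re z = c with c ^ (2 al) > x the remainder of the expansion in
    powers of x tends to 0 geometrically; then the line is moved to Re z = 2. *)
Lemma mittag_leffler1E al x : 0 < al < 1 -> 0 <= x ->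
  mittag_leffler1 al (- x) = ml_integral al x 2 (2 * al - 1).
Proof.
move=> hal x0; have [al0 al1] := andP hal.
have al2 : 0 < 2 * al by rewrite mulr_gt0.
(* this choice gives c ^ (2 al) >= x + 1 > x *)
pose c := 1 + (x + 1) `^ (2 * al)^-1.
have x1 : 0 < x + 1 by rewrite ltr_wpDl.
have c1 : 1 < c by rewrite /c ltrDl powR_gt0.
have c0 : 0 < c by exact: lt_trans c1.
have cx : x < c `^ (2 * al).
  apply: (@lt_le_trans _ _ (x + 1)); first by rewrite ltrDl.
  have {1}-> : x + 1 = ((x + 1) `^ (2 * al)^-1) `^ (2 * al).
    by rewrite -powRrM mulVf ?gt_eqF// powRr1// ltW.
  apply: ge0_ler_powR; rewrite ?nnegrE ?powR_ge0 ?(ltW al2) ?(ltW c0)//.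
  by rewrite /c lerDr.
rewrite (ml_shift (c' := c))//; last by rewrite ltr1n.
have [d d0 hd] := ml_den_lower hal.
have [K K0 hK] := @gauss_pow_bound R c (- 1).
set r := x / c `^ (2 * al).
have cp0 : 0 < c `^ (2 * al) by exact: powR_gt0.
have r0 : 0 <= r by rewrite divr_ge0// ltW.
have r1 : r < 1 by rewrite ltr_pdivrMr// mul1r.
have bnd n : `|(- x) ^+ n * ml_integral al x c (2 * al - 1 - 2 * al * n%:R)| <=
    ml_const * (d^-1 * K) * r ^+ n.
  rewrite normrM normrX normrN (ger0_norm x0) /r expr_div_n mulrCA.
  apply: ler_wpM2l; first by rewrite exprn_ge0.
  rewrite -[leRHS]mulrA; apply: ml_integral_bound => // y.
  have Rc : 0 < Re (vline c y) by rewrite Re_vline.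
  have [|||_ h] := hd al x (vline c y); rewrite ?al0 ?lexx//.
  rewrite normcM normc_gauss_vline.
  apply: (le_trans (ler_wpM2l (expR_ge0 _) (normc_ml_le _ d0 Rc h))).
  have n0 := normc_gt0 Rc.
  have -> : 2 * al - 1 - 2 * al * n%:R - 2 * al = - 1 + - (2 * al * n%:R) by ring.
  rewrite powRD; last by apply/implyP => _; rewrite gt_eqF.
  have h1 : expR (c ^+ 2 - y ^+ 2) * normc (vline c y) `^ (- 1) <= K * expR (- 1 * y).
    by apply: hK; rewrite ?lexx ?andbT// ltW.
  have h2 : normc (vline c y) `^ (- (2 * al * n%:R)) <= ((c `^ (2 * al)) ^+ n)^-1.
    rewrite powRN powRrM powR_mulrn ?powR_ge0//.
    rewrite lef_pV2 ?posrE ?exprn_gt0// ?powR_gt0//.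
    apply: lerXn2r; rewrite ?nnegrE ?powR_ge0//.
    apply: ge0_ler_powR; rewrite ?nnegrE ?(ltW al2) ?(ltW c0) ?(ltW n0)//.
    by apply: normc_vline_ge; rewrite ltW.
  set N1 := _ `^ (- 1) in h1 *; set Nn := _ `^ (- _) in h2 *.
  rewrite [leLHS](_ : _ = d^-1 * (expR (c ^+ 2 - y ^+ 2) * N1 * Nn)); last by ring.
  rewrite [leRHS](_ : _ = d^-1 * (K * expR (- 1 * y) * ((c `^ (2 * al)) ^+ n)^-1)); last by ring.
  apply: ler_wpM2l; first by rewrite invr_ge0 ltW.
  by apply: ler_pM => //; rewrite ?mulr_ge0 ?expR_ge0 ?powR_ge0.
rewrite /mittag_leffler1; apply/cvg_lim => //.
have cvr : ml_const * (d^-1 * K) * r ^+ n @[n --> \oo] --> (0 : R).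
  suff : ml_const * (d^-1 * K) * r ^+ n @[n --> \oo] --> ml_const * (d^-1 * K) * 0.
    by rewrite mulr0.
  by apply: cvgM; [exact: cvg_cst|apply: cvg_expr; rewrite ger0_norm].
apply/cvgrPdist_le => e e0; near=> n.
rewrite (ml_integral_expand_x n hal x0 (ltW c1)) /series /=.
rewrite addrAC subrr add0r; apply: (le_trans (bnd n)).
have : `|0 - ml_const * (d^-1 * K) * r ^+ n| <= e.
  by near: n; move/cvgrPdist_le : cvr => /(_ _ e0).
by rewrite sub0r normrN; apply: le_trans; exact: ler_norm.
Unshelve. all: by end_near. Qed.

Lemma ml_integral_expand_invx al x m : 0 < al < 1 -> 0 < x ->
  ml_integral al x 2 (2 * al - 1) =
  \sum_(0 <= k < m) (- 1) ^+ k * rgamma (1 - k.+1%:R * al) / x ^+ k.+1 +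
  (- 1) ^+ m / x ^+ m * ml_integral al x 2 (2 * al * m.+1%:R - 1).
Proof.
move=> hal x0; have [al0 al1] := andP hal.
have c1 : (1 : R) <= 2 by rewrite ler1n.
elim: m => [|m ih].
  by rewrite big_geq// add0r !expr0 divr1 mul1r mulr1.
rewrite ih big_nat_recr//= -[RHS]addrA; congr (_ + _).
have := ml_step (2 * al * m.+1%:R - 1) hal (ltW x0) c1.
have -> : 2 * al * m.+1%:R - 1 + 2 * al = 2 * al * m.+2%:R - 1.
  by rewrite -[m.+2%:R]natr1; ring.
have -> : hankel 2 (2 * al * m.+1%:R - 1) = rgamma (1 - m.+1%:R * al).
  by rewrite -(hankel_rgamma _ c1); congr hankel; ring.
move=> <-; have xn : x != 0 by rewrite gt_eqF.
by rewrite !exprS; field; rewrite expf_neq0.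
Qed.

(** The constant does not depend on al: the remainder is an integral over the
    fixed line Re z = 2, in which the denominator is at least a constant times x. *)
Theorem mittag_leffler_expansion al1 m : 0 < al1 < 1 ->
  exists2 C, 0 <= C & forall al x, 0 < al <= al1 -> 0 < x ->
  `|mittag_leffler1 al (- x) -
    \sum_(0 <= k < m) (- 1) ^+ k * rgamma (1 - k.+1%:R * al) / x ^+ k.+1|
  <= C / x ^+ m.+1.
Proof.
move=> hal1; have [al10 al11] := andP hal1.
have [d d0 hd] := ml_den_lower hal1.
have [K K0 hK] := @gauss_pow_bound R 2 (2 * m.+1%:R).
exists (ml_const * (d^-1 * K)).
  by rewrite mulr_ge0 ?ml_const_ge0// mulr_ge0 ?invr_ge0 ?ltW.
move=> al x /andP[al0 ala] x0.
have hal : 0 < al < 1 by rewrite al0 (le_lt_trans ala).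
rewrite mittag_leffler1E ?(ltW x0)// (ml_integral_expand_invx m hal x0) [X in `|X|]addrC addKr.
rewrite normrM normf_div !normrX normrN1 expr1n (gtr0_norm x0) mul1r.
rewrite [leRHS](_ : _ = (x ^+ m)^-1 * (ml_const * ((d * x)^-1 * K))); last first.
  by rewrite exprS; field; rewrite expf_neq0 ?gt_eqF.
apply: ler_wpM2l; first by rewrite invr_ge0 exprn_ge0// ltW.
have h20 : (0 : R) < 2 by [].
apply: ml_integral_bound => //; first exact: ltW.
move=> y; have Rc : 0 < Re (vline 2 y) by rewrite Re_vline.
have [|||h _] := hd al x (vline 2 y); rewrite ?al0 ?(ltW x0)//.
have dx0 : 0 < d * x by rewrite mulr_gt0.
rewrite normcM normc_gauss_vline normcM normcV normc_pow//.
apply: (@le_trans _ _ ((d * x)^-1 *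
    (expR (2 ^+ 2 - y ^+ 2) * normc (vline 2 y) `^ (2 * al * m.+1%:R - 1)))).
  rewrite [leLHS]mulrA [leLHS]mulrC; apply: ler_wpM2r.
    by rewrite mulr_ge0 ?expR_ge0 ?powR_ge0.
  by rewrite lef_pV2 ?posrE// (lt_le_trans _ h).
rewrite -[leRHS]mulrA; apply: ler_wpM2l; first by rewrite invr_ge0 ltW.
apply: hK; first by rewrite ler1n lexx.
have : 2 * al * m.+1%:R <= 2 * m.+1%:R.
  by rewrite ler_wpM2r// ler_piMr// ltW// (le_lt_trans ala).
lra.
Qed.

(** Hankel's integral is continuous in its parameter by domination; this also
    glues together the pieces of the definition of [rgamma], whose number of
    factors jumps. *)
Lemma continuous_rgamma : continuous (@rgamma R).
Proof.
move=> x0.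
have c1 : (1 : R) <= 2 by rewrite ler1n.
have h20 : (0 : R) < 2 by [].
pose F x y := Re (cexp (vline 2 y ^+ 2) * cpow (vline 2 y) (1 - 2 * x)).
have -> : @rgamma R = (fun x => 2 / pi * int0y (F x)).
  by apply/funext => x; rewrite -(hankel_rgamma x c1).
apply: cvgM; first exact: cvg_cst.
have [K K0 hK] := @gauss_pow_bound R 2 (1 - 2 * (x0 - 1)).
have Fb x y : x0 - 1 < x -> `|F x y| <= K * expR (- 1 * y).
  move=> hx; apply: (le_trans (ler_normc_Re _)).
  rewrite normcM normc_gauss_vline normc_pow_vline//; apply: hK; last by lra.
  by rewrite ler1n lexx.
have := @continuity_under_integral R _ _ (@lebesgue_measure R) F
  (`]0, +oo[%classic : set R) (measurable_itv _) (x0 - 1) (x0 + 1) _ _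
  (fun y => K * expR (- 1 * y)) _ _ x0.
apply.
- by move=> x _; exact: integrable0y_hankel.
- apply/aeW => y _ x _; apply: cdiff_continuous_Re; apply: cdiffM.
    exact: cdiff_cst.
  apply: cdiff_exp; apply: cdiffM; last exact: cdiff_cst.
  rewrite (_ : (fun _ => _) = (fun t : R => 1 + t%:C * (- 2%:C))).
    exact: cdiff_line.
  by apply/funext => t; rewrite rmorphB rmorphM /=; ring.
- by apply: integrable0yZ; exact: integrable0y_expRN.
- by move=> x; rewrite /= in_itv/= => /andP[hx _]; apply/aeW => y _; exact: Fb.
- by rewrite inE/= in_itv/=; apply/andP; split; lra.
Qed.

End Expansion.

(** * Spectral sums and logarithms *)

Section SpectralSums.
Context {R : realType}.
Variables (dim : option nat) (b : nat -> R).
Implicit Types (f g : nat -> R).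
Hypothesis b0 : forall n, mode dim n -> 0 <= b n.
Hypothesis bsum : (\sum_(0 <= n <oo | mode dim n) (b n)%:E < +oo)%E.

Let A : R := fine (\sum_(0 <= n <oo | mode dim n) (b n)%:E)%E.

Let sumA : (\sum_(0 <= n <oo | mode dim n) (b n)%:E)%E = A%:E.
Proof.
rewrite /A fineK// ge0_fin_numE//; apply: nneseries_ge0 => n _ mn.
by rewrite lee_fin b0.
Qed.

Lemma spectral_partial_le N : \sum_(0 <= n < N | mode dim n) b n <= A.
Proof.
rewrite -lee_fin -sumA -sumEFin; apply: nneseries_lim_ge => n _ mn.
by rewrite lee_fin b0.
Qed.

Lemma spectral_sum_dominated f B : 0 <= B ->
  (forall n, mode dim n -> `|f n| <= B * b n) ->
  (fun N => \sum_(0 <= n < N | mode dim n) f n) @ \oo --> spectral_sum dim f /\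
  `|spectral_sum dim f| <= B * A.
Proof.
move=> B0 fB; pose g n := if mode dim n then f n else 0.
have gE : (fun N => \sum_(0 <= n < N | mode dim n) f n) = series g.
  by apply/funext => N; rewrite /series /= big_mkcond.
have gN N : series (fun n => `|g n|) N <= B * A.
  apply: (@le_trans _ _ (B * \sum_(0 <= n < N | mode dim n) b n)); last first.
    by apply: ler_wpM2l => //; exact: spectral_partial_le.
  rewrite /series /= mulr_sumr [leRHS]big_mkcond; apply: ler_sum => n _.
  by rewrite /g; case: ifPn => [/fB//|_]; rewrite normr0.
have cabs : cvgn (series (fun n => `|g n|)).
  apply: nondecreasing_is_cvgn.
    by apply/nondecreasing_seqP => n; rewrite /series /= big_nat_recr//= lerDl.
  by exists (B * A) => _ [N _ <-].
have cg : cvgn (series g) by exact: normed_cvg.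
rewrite /spectral_sum gE; split => //.
have cn : (`|series g N|) @[N --> \oo] --> `|limn (series g)| by exact: cvg_norm.
have := cvg_lim (@Rhausdorff _) cn => <-.
apply: limr_le; first by apply: cvgP cn.
near=> N; apply: (le_trans _ (gN N)).
by rewrite /series /=; exact: ler_norm_sum.
Unshelve. all: by end_near. Qed.

End SpectralSums.

Section LogEstimates.
Context {R : realType}.
Implicit Types (r e eta : R).

Lemma ln1D_near0 r : `|r| <= 2^-1 -> 0 < 1 + r /\ `|ln (1 + r)| <= 2 * `|r|.
Proof.
move=> hr; have hr' := hr; rewrite ler_norml in hr'.
have r1 : 0 < 1 + r by lra.
split => //; rewrite ler_norml.
have h1 := ler_norm r; have h2 := ler_norm (- r); rewrite normrN in h2.
have r0 := normr_ge0 r.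
have u : ln (1 + r) <= r by apply: le_ln1Dx; lra.
apply/andP; split; last by lra.
have e : 1 + - r / (1 + r) = (1 + r)^-1 by field; rewrite gt_eqF.
have ri : 0 < (1 + r)^-1 by rewrite invr_gt0.
have v : ln (1 + - r / (1 + r)) <= - r / (1 + r).
  by apply: le_ln1Dx; rewrite -e in ri; lra.
rewrite e in v.
rewrite lnV ?posrE// in v.
have w : - r / (1 + r) <= 2 * `|r|.
  rewrite ler_pdivrMr//; nra.
lra.
Qed.

(** The upper bound holds because (1 + eta) (1 - eta) <= 1. *)
Lemma ln1D_noise e eta : `|e| <= eta -> eta < 1 ->
  0 < 1 + e /\ `|ln (1 + e)| <= - ln (1 - eta).
Proof.
move=> he eta1; have he' := he; rewrite ler_norml in he'.
have e1 : 0 < 1 + e by lra.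
have n1 : 0 < 1 - eta by lra.
split => //; rewrite ler_norml opprK; apply/andP; split.
  by rewrite ler_ln ?posrE//; lra.
rewrite -lnV ?posrE// ler_ln ?posrE ?invr_gt0//.
rewrite -[leRHS]mul1r ler_pdivlMr//.
nra.
Qed.

End LogEstimates.

(** * Expansion of the observation *)

Section Observation.
Context {R : realType}.
Variables (dim : option nat) (lambda a : nat -> R).
Implicit Types (al t : R).
Hypothesis lambda_gt0 : forall n, mode dim n -> 0 < lambda n.
Hypothesis lambda_nd : forall i j, (i <= j)%N -> mode dim j -> lambda i <= lambda j.
Hypothesis hsum :
  (\sum_(0 <= n <oo | mode dim n) (`|a n| / lambda n)%:E < +oo)%E.

(** Without any mode, every positive number will do. *)
Lemma eigenvalue_lower_bound : exists2 l, 0 < l & forall n, mode dim n -> l <= lambda n.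
Proof.
have [m0|m0] := boolP (mode dim 0).
  by exists (lambda 0); [exact: lambda_gt0|move=> n; exact: lambda_nd].
exists 1 => // n mn; move: m0 mn; rewrite /mode; case: dim => // d.
by rewrite -leqNgt leqn0 => /eqP ->.
Qed.

Lemma coefficient_ge0 n : mode dim n -> 0 <= `|a n| / lambda n.
Proof. by move=> mn; rewrite divr_ge0// ltW// lambda_gt0. Qed.

(** Termwise expansion at x = lambda_n t ^ al. The finitely many main terms sum
    to moments, and the remainders are dominated by |a_n| / lambda_n, the extra
    factor lambda_n ^ (- m) being bounded. *)
Lemma observation_expansion al1 m : 0 < al1 < 1 ->
  exists2 K, 0 <= K & forall al t, 0 < al <= al1 -> 0 < t ->
  `|observation dim lambda a al t -
    \sum_(0 <= k < m) (- 1) ^+ k * rgamma (1 - k.+1%:R * al) / (t `^ al) ^+ k.+1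
      * resolvent_moment dim lambda a k.+1|
  <= K / (t `^ al) ^+ m.+1.
Proof.
move=> hal1; have [l l0 hl] := eigenvalue_lower_bound.
have [C C0 hC] := mittag_leffler_expansion m hal1.
set S := fine (\sum_(0 <= n <oo | mode dim n) (`|a n| / lambda n)%:E)%E.
have dom := spectral_sum_dominated coefficient_ge0 hsum.
have lpow k n : mode dim n -> (lambda n ^+ k)^-1 <= (l ^+ k)^-1.
  move=> mn; rewrite lef_pV2 ?posrE ?exprn_gt0 ?lambda_gt0//.
  by apply: lerXn2r; rewrite ?nnegrE ?hl// ltW ?lambda_gt0.
have mom k : (fun N => \sum_(0 <= n < N | mode dim n) a n / lambda n ^+ k.+1) @ \oo -->
    resolvent_moment dim lambda a k.+1.
  apply: (dom _ (l ^+ k)^-1 _ _).1; first by rewrite invr_ge0 exprn_ge0// ltW.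
  move=> n mn; have ln0 := lambda_gt0 mn.
  rewrite [leLHS](_ : _ = (lambda n ^+ k)^-1 * (`|a n| / lambda n)); last first.
    by rewrite normf_div normrX (gtr0_norm ln0) exprSr invfM; ring.
  by apply: ler_wpM2r; [exact: coefficient_ge0|exact: lpow].
exists (C / l ^+ m * S).
  rewrite mulr_ge0 ?divr_ge0 ?exprn_ge0 ?(ltW l0)//.
  rewrite fine_ge0//; apply: nneseries_ge0 => n _ mn.
  by rewrite lee_fin coefficient_ge0.
move=> al t hal t0; set tau := t `^ al.
have tau0 : 0 < tau by exact: powR_gt0.
pose c k := (- 1) ^+ k * rgamma (1 - k.+1%:R * al) / tau ^+ k.+1.
pose rest n := a n * mittag_leffler1 al (- lambda n * tau) -
  \sum_(0 <= k < m) c k * (a n / lambda n ^+ k.+1).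
have restb n : mode dim n -> `|rest n| <= C / l ^+ m / tau ^+ m.+1 * (`|a n| / lambda n).
  move=> mn; have ln0 := lambda_gt0 mn.
  have x0 : 0 < lambda n * tau by rewrite mulr_gt0.
  have := hC al (lambda n * tau) hal x0; rewrite -mulNr => h.
  rewrite /rest (_ : \sum_(0 <= k < m) _ = a n * \sum_(0 <= k < m)
     (- 1) ^+ k * rgamma (1 - k.+1%:R * al) / (lambda n * tau) ^+ k.+1); last first.
    rewrite mulr_sumr; apply: eq_bigr => k _; rewrite /c exprMn.
    by field; rewrite !expf_neq0// gt_eqF.
  rewrite -mulrBr normrM.
  apply: (le_trans (ler_wpM2l (normr_ge0 _) h)).
  rewrite [leRHS](_ : _ = `|a n| * ((l ^+ m)^-1 * (C / lambda n / tau ^+ m.+1))); last first.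
    by field; rewrite !expf_neq0 ?gt_eqF.
  apply: ler_wpM2l => //.
  rewrite [leLHS](_ : _ = (lambda n ^+ m)^-1 * (C / lambda n / tau ^+ m.+1)); last first.
    by rewrite exprMn (exprS (lambda n)); field; rewrite !expf_neq0 ?gt_eqF.
  apply: ler_wpM2r; last exact: lpow.
  by rewrite !(divr_ge0, exprn_ge0) ?(ltW ln0) ?(ltW tau0).
have B0 : 0 <= C / l ^+ m / tau ^+ m.+1.
  by rewrite !(divr_ge0, exprn_ge0) ?(ltW l0) ?(ltW tau0).
have [rcv rle] := dom rest _ B0 restb.
have csum : (fun N => \sum_(0 <= k < m) c k *
      \sum_(0 <= n < N | mode dim n) (a n / lambda n ^+ k.+1)) @ \oo -->
    \sum_(0 <= k < m) c k * resolvent_moment dim lambda a k.+1.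
  elim: (m) => [|j ih].
    rewrite big_geq//; under eq_fun do rewrite big_geq//.
    exact: cvg_cst.
  rewrite big_nat_recr//=; under eq_fun do rewrite big_nat_recr//=.
  apply: cvgD => //; apply: cvgM; [exact: cvg_cst|exact: mom].
have tot : (fun N => \sum_(0 <= n < N | mode dim n) a n * mittag_leffler1 al (- lambda n * tau))
    @ \oo --> \sum_(0 <= k < m) c k * resolvent_moment dim lambda a k.+1 + spectral_sum dim rest.
  rewrite (_ : (fun N => _) = (fun N => \sum_(0 <= k < m) c k *
      (\sum_(0 <= n < N | mode dim n) (a n / lambda n ^+ k.+1)) +
      \sum_(0 <= n < N | mode dim n) rest n)); first exact: cvgD csum rcv.
  apply/funext => N.
  under [X in _ = X + _]eq_bigr do rewrite mulr_sumr.
  rewrite exchange_big /= -big_split /=; apply: eq_bigr => n _.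
  by rewrite /rest addrC subrK.
have -> : observation dim lambda a al t =
    \sum_(0 <= k < m) c k * resolvent_moment dim lambda a k.+1 + spectral_sum dim rest.
  exact: (cvg_lim (@Rhausdorff _) tot).
rewrite addrAC subrr add0r (le_trans rle)// -/S.
rewrite [leLHS](_ : _ = C / l ^+ m * S / tau ^+ m.+1)//.
by field; rewrite !expf_neq0 ?gt_eqF.
Qed.

End Observation.

(** * The log-ratio estimator *)

Section Estimator.
Context {R : realType}.
Implicit Types (al t : R).

(** A continuous function without zeros on a compact interval. *)
Lemma leading_coef_lower m (al0 al1 : R) : al0 <= al1 ->
  (forall al, al0 <= al <= al1 -> leading_coef m al != 0) ->
  exists2 k, 0 < k & forall al, al0 <= al <= al1 -> k <= `|leading_coef m al|.
Proof.
move=> al01 hc.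
have cont : continuous (fun al => `|leading_coef m al|).
  move=> al; rewrite /leading_coef.
  apply: (@continuous_comp _ _ _
    (fun al => (-1) ^+ m.+1 * rgamma (1 - m%:R * al)) Num.norm);
    last exact: norm_continuous.
  apply: cvgM; first exact: cvg_cst.
  apply: (@continuous_comp _ _ _ (fun al => 1 - m%:R * al) rgamma); last exact: continuous_rgamma.
  apply: cvgB; first exact: cvg_cst.
  by apply: cvgM; [exact: cvg_cst|exact: cvg_id].
have [al alI hmin] := @EVT_min R (fun al => `|leading_coef m al|) al0 al1 al01
  (continuous_subspaceT cont).
exists `|leading_coef m al|.
  by rewrite normr_gt0; apply: hc; move: alI; rewrite in_itv.
by move=> t ht; apply: hmin; rewrite in_itv.
Qed.

(** The exact leading powers cancel al, and the noise and the relative remainders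
    enter the logarithm additively. *)
Lemma log_ratio_estimatorE m (rho al x y Q r1 r2 e1 e2 : R) :
  (0 < m)%N -> 1 < rho -> 0 < x -> y = rho `^ al * x -> Q != 0 ->
  0 < 1 + r1 -> 0 < 1 + r2 -> 0 < 1 + e1 -> 0 < 1 + e2 ->
  log_ratio_estimator m rho (Q / x ^+ m * (1 + r1) * (1 + e1))
                            (Q / y ^+ m * (1 + r2) * (1 + e2)) - al =
  - (m%:R * ln rho)^-1 *
    (ln (1 + r2) - ln (1 + r1) + (ln (1 + e2) - ln (1 + e1))).
Proof.
move=> m0 rho1 x0 yE Q0 hr1 hr2 he1 he2.
have rho0 : 0 < rho by exact: lt_trans rho1.
have p0 : 0 < rho `^ al by exact: powR_gt0.
have lr : 0 < ln rho by exact: ln_gt0.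
have mn : m%:R != 0 :> R by rewrite pnatr_eq0 -lt0n.
rewrite /log_ratio_estimator.
have -> : Q / y ^+ m * (1 + r2) * (1 + e2) / (Q / x ^+ m * (1 + r1) * (1 + e1)) =
    ((1 + r2) / (1 + r1)) * ((1 + e2) / (1 + e1)) / (rho `^ al) ^+ m.
  rewrite yE exprMn; field.
  by rewrite Q0 !expf_neq0 ?gt_eqF.
rewrite gtr0_norm; last by rewrite !(mulr_gt0, invr_gt0, exprn_gt0).
rewrite ln_div ?posrE ?(mulr_gt0, invr_gt0, exprn_gt0)//.
rewrite lnM ?posrE ?(mulr_gt0, invr_gt0)//.
rewrite !ln_div ?posrE// lnXn// ln_powR -mulr_natl.
by field; rewrite mn gt_eqF.
Qed.

End Estimator.

Unset Implicit Arguments.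
Set Strict Implicit.
Set Printing Implicit Defensive.

Theorem corollary5p3 (R : realType) (dim : option nat) (lambda a : nat -> R)
  (hsum : (\sum_(0 <= n <oo | mode dim n) (`|a n| / lambda n)%:E < +oo)%E)
  (alpha0 alpha1 : R)
  (halpha0 : 0 < alpha0) (halpha01 : alpha0 <= alpha1) (halpha1 : alpha1 < 1)
  (m : nat) (hm : (1 <= m)%N)
  (hS0 : forall k, (1 <= k < m)%N -> resolvent_moment dim lambda a k = 0)
  (hSm : resolvent_moment dim lambda a m != 0)
  (hc : forall alpha, alpha0 <= alpha <= alpha1 -> leading_coef m alpha != 0)
  (rho : R) (hrho : 1 < rho) :
  exists C T : R, [/\ 0 < C, 1 < T &
    forall (H : completeNormedModType R) (dot : {dot H for idfun})
      (Dom : set H) (A : H -> H) (v : nat -> H),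
    spectral_configuration dot Dom A dim lambda v ->
    forall alpha eta eps1 eps2 t : R,
    alpha0 <= alpha <= alpha1 ->
    `|eps1| <= eta -> `|eps2| <= eta -> eta < 1 ->
    T <= t ->
    let d1 := observation dim lambda a alpha t in
    let d2 := observation dim lambda a alpha (rho * t) in
    let d1' := d1 * (1 + eps1) in
    let d2' := d2 * (1 + eps2) in
    [/\ d1' != 0, d2' != 0 &
      `|log_ratio_estimator m rho d1' d2' - alpha|
        <= C * t `^ (- alpha0) + 2 * (- ln (1 - eta)) / (m%:R * ln rho)]].
Proof.
(* the constants are chosen before the Hilbert space; as far as they depend on
   the sign and the order of the eigenvalues, they are taken from any one
   configuration, and without configurations nothing is claimed *)
have [[H [dot [Dom [A [v cfg]]]]]|nocfg] := pselect (exists (H : completeNormedModType R)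
  (dot : {dot H for idfun}) (Dom : set H) (A : H -> H) (v : nat -> H),
  spectral_configuration dot Dom A dim lambda v); last first.
  exists 1, 2; split; rewrite ?ltr1n// => H dot Dom A v cfg.
  by exfalso; apply: nocfg; exists H, dot, Dom, A, v.
have es := configuration_eigen_system cfg.
have lam0 := eigenvalue_gt0 es; have lamnd := eigenvalue_nondecreasing es.
clear H dot Dom A v cfg es.
have hal1 : 0 < alpha1 < 1 by rewrite halpha1 (lt_le_trans halpha0).
have [K K0 hK] := observation_expansion lam0 lamnd hsum m hal1.
have [k k0 hk] := leading_coef_lower halpha01 hc.
set S := resolvent_moment dim lambda a m in hSm.
have S0 : 0 < `|S| by rewrite normr_gt0.
have lr : 0 < ln rho by exact: ln_gt0.
have m0 : 0 < m%:R :> R by rewrite ltr0n.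
pose K' := K / (k * `|S|).
have K'0 : 0 <= K' by rewrite divr_ge0// mulr_ge0// ltW.
pose C := 4 * K' / (m%:R * ln rho) + 1.
(* T ^ alpha0 >= 2 K', so that relative remainders are at most 1/2 after T *)
pose T := 2 + (2 * K') `^ alpha0^-1.
have T1 : 1 < T by rewrite /T ltr_wpDr ?powR_ge0// ltr1n.
exists C, T; split => //.
  by rewrite /C; apply: ltr_wpDl => //; apply: divr_ge0; apply: mulr_ge0 => //; exact: ltW.
move=> _ _ _ _ _ _ alpha eta eps1 eps2 t hal he1 he2 heta Tt d1 d2 d1' d2'.
have al0 : 0 < alpha by case/andP: hal => h _; exact: lt_le_trans h.
have hal' : 0 < alpha <= alpha1 by rewrite al0; case/andP: hal.
pose Q := leading_coef m alpha * S.
have Q0 : Q != 0 by rewrite mulf_neq0// hc.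
have obs s : T <= s -> exists r,
    [/\ observation dim lambda a alpha s = Q / (s `^ alpha) ^+ m * (1 + r),
    `|r| <= K' * s `^ (- alpha0) & `|r| <= 2^-1].
  move=> Ts; have s1 : 1 <= s by rewrite ltW// (lt_le_trans T1).
  have s0 : 0 < s by exact: lt_le_trans s1.
  have tau0 : 0 < s `^ alpha by exact: powR_gt0.
  have := hK alpha s hal' s0.
  have -> : \sum_(0 <= j < m) (-1) ^+ j * rgamma (1 - j.+1%:R * alpha) / (s `^ alpha) ^+ j.+1 *
      resolvent_moment dim lambda a j.+1 = Q / (s `^ alpha) ^+ m.
    have mE : m = m.-1.+1 by rewrite prednK.
    have sgn : (-1) ^+ m.-1 = (-1) ^+ m.+1 :> R by case: (m) hm => // n _; rewrite !exprS /=; ring.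
    rewrite {1}mE big_nat_recr//= -mE big_nat_cond big1 ?add0r.
      by rewrite /Q /leading_coef -/S sgn; ring.
    by move=> j /andP[/andP[_ jm] _]; rewrite hS0 ?mulr0//= [X in (_ < X)%N]mE ltnS.
  set D := Q / _; set O := observation _ _ _ _ _ => hO.
  have D0 : D != 0 by rewrite /D mulf_neq0// invr_eq0 expf_neq0// gt_eqF.
  have rb : `|(O - D) / D| <= K' * s `^ (- alpha0).
    rewrite normf_div ler_pdivrMr ?normr_gt0//; apply: (le_trans hO).
    have kS0 : 0 < k * `|S| by rewrite mulr_gt0.
    have -> : K / (s `^ alpha) ^+ m.+1 =
        K' * (s `^ alpha)^-1 * (k * `|S| / (s `^ alpha) ^+ m).
      by rewrite /K' exprS; field; rewrite expf_neq0 ?gt_eqF.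
    apply: ler_pM.
    - by rewrite mulr_ge0// invr_ge0 ltW.
    - by rewrite divr_ge0 ?exprn_ge0// ltW.
    - apply: ler_wpM2l => //; rewrite -powRN; apply: ler_powR => //.
      by rewrite lerN2; case/andP: hal.
    rewrite /D normf_div normrM normrX (gtr0_norm tau0).
    apply: ler_wpM2r; first by rewrite invr_ge0 exprn_ge0 ?(ltW tau0).
    by apply: ler_wpM2r; [exact: ltW|exact: hk].
  exists ((O - D) / D); split => //; first by field.
  apply: (le_trans rb); rewrite powRN ler_pdivrMr ?powR_gt0//.
  rewrite mulrC -ler_pdivrMr ?invr_gt0// invrK mulrC.
  have {1}-> : 2 * K' = ((2 * K') `^ alpha0^-1) `^ alpha0.
    by rewrite -powRrM mulVf ?gt_eqF// powRr1// mulr_ge0.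
  apply: ge0_ler_powR; rewrite ?nnegrE ?powR_ge0 ?(ltW halpha0) ?(ltW s0)//.
  by apply: le_trans Ts; rewrite /T lerDr.
have t1 : 1 <= t by rewrite ltW// (lt_le_trans T1).
have t0 : 0 < t by exact: lt_le_trans t1.
have rho0 : 0 < rho by exact: lt_trans hrho.
have tr : t <= rho * t by rewrite ler_peMl ?(ltW t0) ?(ltW hrho).
have [r1 [oE1 b1 c1]] := obs t Tt.
have [r2 [oE2 b2 c2]] := obs (rho * t) (le_trans Tt tr).
have {}b2 : `|r2| <= K' * t `^ (- alpha0).
  apply: (le_trans b2); apply: ler_wpM2l => //.
  rewrite !powRN lef_pV2 ?posrE ?powR_gt0 ?mulr_gt0//.
  by apply: ge0_ler_powR; rewrite ?nnegrE ?mulr_ge0 ?(ltW halpha0) ?(ltW t0) ?(ltW rho0).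
have [pos1 l1] := ln1D_near0 c1.
have [pos2 l2] := ln1D_near0 c2.
have [q1 n1] := ln1D_noise he1 heta.
have [q2 n2] := ln1D_noise he2 heta.
have x0 : 0 < t `^ alpha by exact: powR_gt0.
have y0 : 0 < (rho * t) `^ alpha by rewrite powR_gt0// mulr_gt0.
have yE : (rho * t) `^ alpha = rho `^ alpha * t `^ alpha by rewrite powRM ?(ltW rho0) ?(ltW t0).
have nz x r e : 0 < x -> 0 < 1 + r -> 0 < 1 + e ->
    Q / x ^+ m * (1 + r) * (1 + e) != 0.
  move=> xp rp ep; apply: mulf_neq0; last exact: lt0r_neq0.
  apply: mulf_neq0; last exact: lt0r_neq0.
  by apply: mulf_neq0 => //; rewrite invr_eq0 expf_neq0// lt0r_neq0.
split; first by rewrite /d1' /d1 oE1 nz.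
  by rewrite /d2' /d2 oE2 nz.
rewrite /d1' /d2' /d1 /d2 oE1 oE2 log_ratio_estimatorE//.
have iv : 0 < (m%:R * ln rho)^-1 by rewrite invr_gt0 mulr_gt0.
rewrite normrM normrN (gtr0_norm iv).
set L := ln (1 - eta) in n1 n2 *.
set U := t `^ (- alpha0) in b1 b2 *.
have U0 : 0 <= U by exact: powR_ge0.
have big : `|ln (1 + r2) - ln (1 + r1) + (ln (1 + eps2) - ln (1 + eps1))| <=
    4 * K' * U + 2 * (- L).
  have {}l1 := le_trans l1 (ler_wpM2l (ler0n R 2) b1).
  have {}l2 := le_trans l2 (ler_wpM2l (ler0n R 2) b2).
  have -> : 4 * K' * U + 2 * (- L) =
      2 * (K' * U) + 2 * (K' * U) + (- L + - L) by ring.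
  apply: (le_trans (ler_normD _ _)).
  apply: (le_trans (lerD (ler_normB _ _) (ler_normB _ _))).
  by apply: lerD; apply: lerD.
apply: (@le_trans _ _ ((m%:R * ln rho)^-1 * (4 * K' * U + 2 * (- L)))).
  by apply: ler_wpM2l => //; exact: ltW.
have -> : (m%:R * ln rho)^-1 * (4 * K' * U + 2 * - L) =
    4 * K' / (m%:R * ln rho) * U + 2 * - L / (m%:R * ln rho) by ring.
by rewrite lerD2r /C; apply: ler_wpM2r => //; rewrite lerDl.
Qed.
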